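(* Let $A:\mathbb R\to\mathbb R^{n\times n}$ be continuous with $\sup_{t}\|A(t)\|=\mu<\infty$; let $f:\mathbb R\times\mathbb R^n\times\mathbb R^n\to\mathbb R^n$, $f=f(t,x,w)$, be continuous in its first argument with $f(t,0,0)=0$ and $\|f(t,y_1,w_1)-f(t,y_2,w_2)\|\le l(\|y_1-y_2\|+\|w_1-w_2\|)$; let $x'=A(t)x$ have an exponential dichotomy on $\mathbb R$ with constants $K,\sigma>0$; and let $lM\theta[1+M(1+l\theta)e^{Ml\theta}]<m$, where $M=e^{\mu\theta}$, $m=e^{-\mu\theta}$. Assume moreover that $f(t,x,w)$ is uniformly continuously differentiable in $x,w$ for all $t,x,w$. Let $\epsilon>0$, $\alpha\in(0,\sigma)$ and let the Lipschitz constant $L$ of $(g_+,g_-)$ be sufficiently small. Then the function $F(t,u)$ described in the context, whose graph $v=F(t,u)$ is the integral surface $S^+$ of the reduced system, is continuously differentiable in $u$ for all $t,u$.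
   Context: $\|\cdot\|$ is the Euclidean norm and the induced operator norm. $(\theta_i)_{i\in\mathbb Z}$ is a strictly increasing real sequence with $|\theta_i|\to\infty$ as $|i|\to\infty$ and $\theta_{i+1}-\theta_i\le\theta$ for all $i$, where $\theta>0$; $\beta(t)=\theta_i$ for $\theta_i\le t<\theta_{i+1}$. ''Uniformly continuously differentiable in $x,w$'' means: the partial derivatives of $f$ with respect to $x$ and $w$ exist and are uniformly continuous in $(x,w)$, uniformly in $t$. Exponential dichotomy: for a fundamental matrix $X(t)$ of $x'=A(t)x$ there is a projection $P$ with $\|X(t)PX^{-1}(s)\|\le Ke^{-\sigma(t-s)}$ for $t\ge s$ and $\|X(t)(I-P)X^{-1}(s)\|\le Ke^{-\sigma(s-t)}$ for $t\le s$. Reduced system: the equation $y'=A(t)y+f(t,y(t),y(\beta(t)))$ is transformed by $y=Q(t)z$, where $Q$ is a Lyapunov matrix ($C^1$, with $Q,Q',Q^{-1}$ bounded on $\mathbb R$) block-diagonalizing $x'=A(t)x$ according to the dichotomy, into $u'=B_+(t)u+g_+(t,z(t),z(\beta(t)))$, $v'=B_-(t)v+g_-(t,z(t),z(\beta(t)))$ with $z=(u,v)$, $u\in\mathbb R^k$, $v\in\mathbb R^{n-k}$, $k=\operatorname{rank}P$, $\operatorname{diag}\{B_+,B_-\}=Q^{-1}AQ-Q^{-1}Q'$ and $(g_+,g_-)(t,z,w)=Q^{-1}(t)f(t,Q(t)z,Q(\beta(t))w)$. $L$ is a constant with $\|g_+(t,z_1,w_1)-g_+(t,z_2,w_2)\|+\|g_-(t,z_1,w_1)-g_-(t,z_2,w_2)\|\le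 L(\|z_1-z_2\|+\|w_1-w_2\|)$ for all $t\in\mathbb R$, $z_i,w_i\in\mathbb R^n$. The fundamental matrices $U(t,s)$, $V(t,s)$ of $u'=B_+(t)u$, $v'=B_-(t)v$ (with $U(s,s)=I$, $V(s,s)=I$) satisfy $\|U(t,s)\|\le Ke^{-\sigma(t-s)}$ for $t\ge s$ and $\|V(t,s)\|\le Ke^{-\sigma(s-t)}$ for $t\le s$. Solutions: a solution on $\mathbb R$ is a continuous function on $\mathbb R$, differentiable except possibly at the points $\theta_i$ (where the right derivative exists), satisfying the system on every $(\theta_i,\theta_{i+1})$ and with right derivatives at the $\theta_i$. A solution with initial data $(t_0,z_0)$, $\theta_i\le t_0<\theta_{i+1}$, is a function on $[\theta_i,\infty)$ with the same properties there and $z(t_0)=z_0$; it is continued on $\mathbb R$ if it extends to a solution on $\mathbb R$. Function $F$: for $L$ sufficiently small (depending on $\epsilon,\alpha,K,\sigma,\theta$), $F:\mathbb R\times\mathbb R^k\to\mathbb R^{n-k}$ is the continuous function with $F(t,0)=0$, $\|F(t,u_1)-F(t,u_2)\|\le\frac{2K^2L(1+e^{\sigma\theta})}{\sigma+\alpha}\|u_1-u_2\|$, such that for all $(t_0,u_0)$ the solution $z$ with $z(t_0)=(u_0,F(t_0,u_0))$ is continued on $\mathbb R$ and satisfies $\|z(t)\|\le(K+\epsilon)\|u_0\|e^{-\alpha(t-t_0)}$ for $t\ge t_0$. *)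

(* Defs.v *)
From mathcomp Require Import all_boot all_order all_algebra.
From mathcomp Require Import all_classical all_reals all_analysis.
Import Order.TTheory GRing.Theory Num.Theory.
Import numFieldNormedType.Exports.

Set Implicit Arguments.
Unset Strict Implicit.
Unset Printing Implicit Defensive.

Local Open Scope classical_set_scope.
Local Open Scope ring_scope.

(* The norm of the library on matrices is the maximum norm.  It is only used
   for the topology; all estimates use the Euclidean norm and the induced
   operator norm below. *)
Definition enorm {R : realType} {n : nat} (x : 'cV[R]_n) : R :=
  Num.sqrt (\sum_(i < n) x i 0 ^+ 2).

Definition opnorm {R : realType} {m n : nat} (A : 'M[R]_(m, n)) : R :=
  sup [set enorm (A *m x) | x in [set x : 'cV[R]_n | enorm x <= 1]].

Definition switching_times {R : realType} (th : R) (theta : int -> R) : Prop :=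
  [/\ forall i : int, theta i < theta (i + 1),
      forall C : R, exists N : nat, forall i : int,
        (N <= `|i|)%N -> C <= `|theta i|
    & forall i : int, theta (i + 1) - theta i <= th].

Definition is_beta {R : realType} (theta : int -> R) (beta : R -> R) : Prop :=
  forall (i : int) (t : R), theta i <= t < theta (i + 1) -> beta t = theta i.

Definition fundamental_matrix {R : realType} {n : nat} (A X : R -> 'M[R]_n) :
    Prop :=
  forall t : R, X t \in unitmx /\ is_derive t 1 X (A t *m X t).

Definition exp_dichotomy {R : realType} {n : nat} (A X : R -> 'M[R]_n)
    (P : 'M[R]_n) (K sigma : R) : Prop :=
  [/\ fundamental_matrix A X,
      P *m P = P,
      forall t s : R, s <= t ->
        opnorm (X t *m P *m invmx (X s)) <= K * expR (- sigma * (t - s))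
    & forall t s : R, t <= s ->
        opnorm (X t *m (1%:M - P) *m invmx (X s))
          <= K * expR (- sigma * (s - t))].

Definition transition_matrix {R : realType} {n : nat} (B : R -> 'M[R]_n)
    (U : R -> R -> 'M[R]_n) : Prop :=
  forall s : R, U s s = 1%:M /\
    forall t : R, is_derive t 1 (fun r : R => U r s) (B t *m U t s).

Definition bounded_mx {R : realType} {n : nat} (Q : R -> 'M[R]_n) : Prop :=
  exists C : R, forall t : R, opnorm (Q t) <= C.

Definition lyapunov_matrix {R : realType} {n : nat} (Q : R -> 'M[R]_n) : Prop :=
  [/\ forall t : R, derivable Q t 1,
      continuous (derive1 Q),
      forall t : R, Q t \in unitmx
    & [/\ bounded_mx Q, bounded_mx (derive1 Q)
        & bounded_mx (fun t => invmx (Q t))]].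

(* [fx t x w] and [fw t x w] are the Jacobian matrices of the partial maps
   [f t ^~ w] at [x] and [f t x] at [w]. *)
Definition unif_cont_diff {R : realType} {n : nat}
    (f : R -> 'cV[R]_n -> 'cV[R]_n -> 'cV[R]_n) : Prop :=
  exists fx fw : R -> 'cV[R]_n -> 'cV[R]_n -> 'M[R]_n,
    (forall (t : R) (x w : 'cV[R]_n),
       is_diff x (fun y : 'cV[R]_n => f t y w) (mulmx (fx t x w)) /\
       is_diff w (fun y : 'cV[R]_n => f t x y) (mulmx (fw t x w))) /\
    (forall e : R, 0 < e -> exists2 d : R, 0 < d &
       forall (t : R) (x1 x2 w1 w2 : 'cV[R]_n),
         enorm (x1 - x2) < d -> enorm (w1 - w2) < d ->
         opnorm (fx t x1 w1 - fx t x2 w2) < e /\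
         opnorm (fw t x1 w1 - fw t x2 w2) < e).

Definition cont_diff {R : realType} {k q : nat} (h : 'cV[R]_k -> 'cV[R]_q) :
    Prop :=
  exists2 J : 'cV[R]_k -> 'M[R]_(q, k),
    forall u : 'cV[R]_k, is_diff u h (mulmx (J u)) & continuous J.

Definition right_derivative {R : realType} {n : nat} (z : R -> 'cV[R]_n) (t : R)
    (d : 'cV[R]_n) : Prop :=
  (h^-1 *: (z (t + h) - z t)) @[h --> 0^'+] --> d.

(* [z] satisfies z'(t) = rhs(t, z(t), z(beta(t))) on
   [theta i, theta (i + 1)), with the right derivative at theta i. *)
Definition solves_on {R : realType} {n : nat} (theta : int -> R) (beta : R -> R)
    (rhs : R -> 'cV[R]_n -> 'cV[R]_n -> 'cV[R]_n) (i : int)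
    (z : R -> 'cV[R]_n) : Prop :=
  (forall t : R, theta i < t < theta (i + 1) ->
     is_derive t 1 z (rhs t (z t) (z (beta t)))) /\
  right_derivative z (theta i)
    (rhs (theta i) (z (theta i)) (z (beta (theta i)))).

Definition solution {R : realType} {n : nat} (theta : int -> R) (beta : R -> R)
    (rhs : R -> 'cV[R]_n -> 'cV[R]_n -> 'cV[R]_n) (z : R -> 'cV[R]_n) : Prop :=
  continuous z /\ forall i : int, solves_on theta beta rhs i z.

(* For theta i <= t0 < theta (i + 1) the domain [theta i, +oo) of the solution
   is [beta t0, +oo); the values of [z] outside of it are irrelevant. *)
Definition solution_from {R : realType} {n : nat} (theta : int -> R)
    (beta : R -> R) (rhs : R -> 'cV[R]_n -> 'cV[R]_n -> 'cV[R]_n)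
    (t0 : R) (z0 : 'cV[R]_n) (z : R -> 'cV[R]_n) : Prop :=
  [/\ {within `[beta t0, +oo[, continuous z},
      forall i : int, beta t0 <= theta i -> solves_on theta beta rhs i z
    & z t0 = z0].

Definition continued {R : realType} {n : nat} (theta : int -> R)
    (beta : R -> R) (rhs : R -> 'cV[R]_n -> 'cV[R]_n -> 'cV[R]_n)
    (t0 : R) (z : R -> 'cV[R]_n) : Prop :=
  exists2 y : R -> 'cV[R]_n, solution theta beta rhs y &
    forall t : R, beta t0 <= t -> y t = z t.

Definition reduced_g {R : realType} {n : nat} (beta : R -> R)
    (Q : R -> 'M[R]_n) (f : R -> 'cV[R]_n -> 'cV[R]_n -> 'cV[R]_n)
    (t : R) (z w : 'cV[R]_n) : 'cV[R]_n :=
  invmx (Q t) *m f t (Q t *m z) (Q (beta t) *m w).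

Definition g_plus {R : realType} {k q : nat} (beta : R -> R)
    (Q : R -> 'M[R]_(k + q))
    (f : R -> 'cV[R]_(k + q) -> 'cV[R]_(k + q) -> 'cV[R]_(k + q))
    (t : R) (z w : 'cV[R]_(k + q)) : 'cV[R]_k :=
  usubmx (reduced_g beta Q f t z w).

Definition g_minus {R : realType} {k q : nat} (beta : R -> R)
    (Q : R -> 'M[R]_(k + q))
    (f : R -> 'cV[R]_(k + q) -> 'cV[R]_(k + q) -> 'cV[R]_(k + q))
    (t : R) (z w : 'cV[R]_(k + q)) : 'cV[R]_q :=
  dsubmx (reduced_g beta Q f t z w).

Definition reduced_rhs {R : realType} {k q : nat} (Bp : R -> 'M[R]_k)
    (Bm : R -> 'M[R]_q)
    (gp : R -> 'cV[R]_(k + q) -> 'cV[R]_(k + q) -> 'cV[R]_k)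
    (gm : R -> 'cV[R]_(k + q) -> 'cV[R]_(k + q) -> 'cV[R]_q)
    (t : R) (z w : 'cV[R]_(k + q)) : 'cV[R]_(k + q) :=
  col_mx (Bp t *m usubmx z + gp t z w) (Bm t *m dsubmx z + gm t z w).

Definition splus_function {R : realType} {k q : nat} (theta : int -> R)
    (beta : R -> R)
    (rhs : R -> 'cV[R]_(k + q) -> 'cV[R]_(k + q) -> 'cV[R]_(k + q))
    (K sigma th eps alpha L : R) (F : R -> 'cV[R]_k -> 'cV[R]_q) : Prop :=
  [/\ continuous (fun p : R * 'cV[R]_k => F p.1 p.2),
      forall t : R, F t 0 = 0,
      forall (t : R) (u1 u2 : 'cV[R]_k),
        enorm (F t u1 - F t u2)
          <= 2 * K ^+ 2 * L * (1 + expR (sigma * th)) / (sigma + alpha)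
             * enorm (u1 - u2)
    & forall (t0 : R) (u0 : 'cV[R]_k), exists z : R -> 'cV[R]_(k + q),
        [/\ solution_from theta beta rhs t0 (col_mx u0 (F t0 u0)) z,
            continued theta beta rhs t0 z
          & forall t : R, t0 <= t ->
              enorm (z t) <= (K + eps) * enorm u0 * expR (- alpha * (t - t0))]].

(* Main.v *)
(* Integrals are avoided: every estimate compares a curve with an explicit
   exponential through the mean value inequality.

   Let [tau] be the switching time preceding [t].  The difference of two
   decaying solutions solves the linear system up to an error bounded by
   [L (|Y s| + |Y (beta s)|)], so for small [L] the dichotomy bounds it on
   [[tau, +oo)] by its first block at [tau].  Starting at [tau] is essential:
   there [beta tau = tau], so the constants depend only on [K], [sigma], [th]
   and [alpha], whereas the backward growth on [[tau, t]] is not controlled by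
   these.  Since the nonlinearity is strictly differentiable uniformly in time,
   the same estimate applied to differences of difference quotients shows that
   these are Cauchy, so the solution through [(a, F tau a)], evaluated at [t],
   is a strictly differentiable function [(Phi a, Psi a)] of [a].

   The point [(u, F t u)] lies on the solution through [(a u, F tau (a u))] for
   some [a u], by uniqueness of decaying solutions; the condition on [l] makes
   [u |-> a u] Lipschitz.  From [Phi (a u) = u] the derivative of [Phi] at [a u]
   is surjective, hence invertible, and [F t] has the strict derivative
   [Psi' Phi'^-1] at [u].  Strict differentiability everywhere is C^1. *)

Require Import Defs.
From mathcomp Require Import all_boot all_order all_algebra.
From mathcomp Require Import all_classical all_reals all_analysis.
From mathcomp Require Import ring lra zify.
Import Order.TTheory GRing.Theory Num.Theory.
Import numFieldNormedType.Exports.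

Local Open Scope classical_set_scope.
Local Open Scope ring_scope.

(** * The Euclidean norm and the operator norm *)

Definition edot {R : realType} {n : nat} (x y : 'cV[R]_n) : R :=
  \sum_(i < n) x i 0 * y i 0.

Lemma edotC {R : realType} {n} (x y : 'cV[R]_n) : edot x y = edot y x.
Proof. by apply: eq_bigr => i _; rewrite mulrC. Qed.

Lemma edotDr {R : realType} {n} (x y z : 'cV[R]_n) :
  edot x (y + z) = edot x y + edot x z.
Proof. by rewrite -big_split; apply: eq_bigr => i _; rewrite mxE mulrDr. Qed.

Lemma edotZr {R : realType} {n} a (x y : 'cV[R]_n) :
  edot x (a *: y) = a * edot x y.
Proof. by rewrite mulr_sumr; apply: eq_bigr => i _; rewrite mxE mulrCA. Qed.

Lemma edotBr {R : realType} {n} (x y z : 'cV[R]_n) :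
  edot x (y - z) = edot x y - edot x z.
Proof. by rewrite edotDr -scaleN1r edotZr mulN1r. Qed.

Lemma enorm_ge0 {R : realType} {n} (x : 'cV[R]_n) : 0 <= enorm x.
Proof. exact: sqrtr_ge0. Qed.
#[local] Hint Extern 0 (is_true (@Order.le _ _ _ (@enorm _ _ _))) =>
  solve [apply: enorm_ge0] : core.

Lemma edotxx {R : realType} {n} (x : 'cV[R]_n) : edot x x = enorm x ^+ 2.
Proof.
rewrite sqr_sqrtr; first by apply: eq_bigr => i _; rewrite expr2.
by apply: sumr_ge0 => i _; exact: sqr_ge0.
Qed.

Lemma coord_le_enorm {R : realType} {n} (x : 'cV[R]_n) i : `|x i 0| <= enorm x.
Proof.
rewrite -sqrtr_sqr ler_wsqrtr// (bigD1 i)//= lerDl.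
by apply: sumr_ge0 => j _; exact: sqr_ge0.
Qed.

Lemma enorm0 {R : realType} {n} : enorm (0 : 'cV[R]_n) = 0.
Proof.
by rewrite /enorm big1 ?sqrtr0// => i _; rewrite mxE expr0n.
Qed.

Lemma enorm_le0 {R : realType} {n} (x : 'cV[R]_n) : enorm x <= 0 -> x = 0.
Proof.
move=> h; apply/matrixP => i j; rewrite ord1 mxE; apply/eqP.
by rewrite -normr_le0 (le_trans (coord_le_enorm _ _)).
Qed.

Lemma enormZ {R : realType} {n} a (x : 'cV[R]_n) :
  enorm (a *: x) = `|a| * enorm x.
Proof.
rewrite /enorm -sqrtr_sqr -sqrtrM ?sqr_ge0//; congr Num.sqrt.
by rewrite mulr_sumr; apply: eq_bigr => i _; rewrite mxE exprMn.
Qed.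

Lemma enormN {R : realType} {n} (x : 'cV[R]_n) : enorm (- x) = enorm x.
Proof. by rewrite -scaleN1r enormZ normrN1 mul1r. Qed.

Lemma enormBC {R : realType} {n} (x y : 'cV[R]_n) : enorm (x - y) = enorm (y - x).
Proof. by rewrite -enormN opprB. Qed.

(** Cauchy-Schwarz: [edot z z] is nonnegative for [z = enorm x *: y - enorm y *: x], and expanding
    it gives the claim times [2 * enorm x * enorm y]. Zero vectors are split off so that this factor
    can be cancelled. *)
Lemma edot_le {R : realType} {n} (x y : 'cV[R]_n) :
  edot x y <= enorm x * enorm y.
Proof.
have [x0|x0] := leP (enorm x) 0.
  rewrite (enorm_le0 _ x0) enorm0 mul0r /edot big1// => i _.
  by rewrite mxE mul0r.
have [y0|y0] := leP (enorm y) 0.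
  rewrite (enorm_le0 _ y0) enorm0 mulr0 /edot big1// => i _.
  by rewrite mxE mulr0.
set z := enorm x *: y - enorm y *: x.
have : 0 <= edot z z by rewrite edotxx sqr_ge0.
rewrite /z edotBr !edotZr ![edot (_ - _) _]edotC !edotBr !edotZr !edotxx.
rewrite [edot y x]edotC => h.
rewrite -(ler_pM2l (mulr_gt0 x0 y0)); move: h.
set a := enorm x; set b := enorm y; nra.
Qed.

Lemma le_of_sqr {R : realType} (a b : R) : 0 <= b -> a ^+ 2 <= b ^+ 2 -> a <= b.
Proof. by move=> b0; rewrite !expr2 => h; rewrite leNgt; apply/negP; nra. Qed.

Lemma enormD {R : realType} {n} (x y : 'cV[R]_n) :
  enorm (x + y) <= enorm x + enorm y.
Proof.
apply: le_of_sqr; first exact: addr_ge0.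
rewrite -edotxx edotDr ![edot (_ + _) _]edotC !edotDr !edotxx [edot y x]edotC.
have := edot_le x y; nra.
Qed.

Lemma enormB {R : realType} {n} (x y : 'cV[R]_n) :
  enorm (x - y) <= enorm x + enorm y.
Proof. by rewrite -[enorm y]enormN enormD. Qed.

Lemma enorm_sum {R : realType} {n} {I : Type} (r : seq I) (F : I -> 'cV[R]_n) :
  enorm (\sum_(i <- r) F i) <= \sum_(i <- r) enorm (F i).
Proof.
elim/big_rec2: _ => [|i y x _ h]; first by rewrite enorm0.
by rewrite (le_trans (enormD _ _)) ?lerD2l.
Qed.

Lemma enorm_delta {R : realType} {n} (j : 'I_n) :
  enorm (delta_mx j 0 : 'cV[R]_n) = 1.
Proof.
rewrite /enorm (bigD1 j)//= !mxE !eqxx expr1n big1 ?addr0 ?sqrtr1//.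
by move=> i ij; rewrite mxE (negbTE ij) expr0n.
Qed.

Lemma enorm_le_sum {R : realType} {n} (x : 'cV[R]_n) :
  enorm x <= \sum_(i < n) `|x i 0|.
Proof.
have -> : x = \sum_(i < n) x i 0 *: delta_mx i 0.
  apply/matrixP => i j; rewrite ord1 summxE (bigD1 i)//= !mxE !eqxx mulr1.
  by rewrite big1 ?addr0// => k ki; rewrite !mxE eq_sym (negbTE ki) mulr0.
rewrite (le_trans (enorm_sum _ _))// ler_sum// => i _.
rewrite enormZ enorm_delta mulr1 summxE (bigD1 i)//= !mxE !eqxx mulr1.
by rewrite big1 ?addr0// => k ki; rewrite !mxE eq_sym (negbTE ki) mulr0.
Qed.

(** Together with [enorm_le_norm] this makes the Euclidean and the maximum norm equivalent, so that
    limits and differentials can be tested with [enorm]. *)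
Lemma norm_le_enorm {R : realType} {n} (x : 'cV[R]_n) : `|x| <= enorm x.
Proof.
rewrite [leLHS]/Num.Def.normr/= mx_normrE.
by apply: bigmax_le => // -[i j] _ /=; rewrite ord1; exact: coord_le_enorm.
Qed.

Lemma coord_le_norm {R : realType} {m n} (x : 'M[R]_(m, n)) i j :
  `|x i j| <= `|x|.
Proof.
rewrite [leRHS]/Num.Def.normr/= mx_normrE.
exact: (le_bigmax _ _ (i, j)).
Qed.

Lemma enorm_le_norm {R : realType} {n} (x : 'cV[R]_n) :
  enorm x <= n%:R * `|x|.
Proof.
rewrite (le_trans (enorm_le_sum _))// (@le_trans _ _ (\sum_(i < n) `|x|))//.
  by rewrite ler_sum// => i _; exact: coord_le_norm.
by rewrite sumr_const card_ord mulr_natl.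
Qed.

(** [opnorm] is a real supremum, which has a default value on unbounded sets; boundedness has to be
    known before it dominates anything. *)
Lemma opnorm_ubound {R : realType} {m n} (A : 'M[R]_(m, n)) :
  has_ubound [set enorm (A *m x) | x in [set x : 'cV[R]_n | enorm x <= 1]].
Proof.
exists (\sum_(i < m) \sum_(j < n) `|A i j|) => _ [x /= x1 <-].
rewrite (le_trans (enorm_le_sum _))// ler_sum// => i _.
rewrite mxE (le_trans (ler_norm_sum _ _ _))// ler_sum// => j _.
rewrite normrM -[leRHS]mulr1 ler_wpM2l// (le_trans _ x1)//.
exact: coord_le_enorm.
Qed.

Lemma opnorm_ge0 {R : realType} {m n} (A : 'M[R]_(m, n)) : 0 <= opnorm A.
Proof.
apply: sup_ubound; first exact: opnorm_ubound.
by exists 0 => /=; rewrite ?mulmx0 enorm0.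
Qed.
#[local] Hint Extern 0 (is_true (@Order.le _ _ _ (@opnorm _ _ _ _))) =>
  solve [apply: opnorm_ge0] : core.

Lemma opnormP {R : realType} {m n} (A : 'M[R]_(m, n)) (x : 'cV[R]_n) :
  enorm (A *m x) <= opnorm A * enorm x.
Proof.
have [x0|x0] := leP (enorm x) 0.
  by rewrite (enorm_le0 _ x0) mulmx0 !enorm0 mulr0.
rewrite -ler_pdivrMr//.
have -> : enorm (A *m x) / enorm x = enorm (A *m ((enorm x)^-1 *: x)).
  by rewrite -scalemxAr enormZ mulrC ger0_norm// invr_ge0.
apply: sup_ubound; first exact: opnorm_ubound.
exists ((enorm x)^-1 *: x) => //=.
by rewrite enormZ ger0_norm ?invr_ge0// mulVf ?gt_eqF.
Qed.

Lemma opnorm_le {R : realType} {m n} (A : 'M[R]_(m, n)) (x : 'cV[R]_n) C :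
  opnorm A <= C -> enorm (A *m x) <= C * enorm x.
Proof. by move=> AC; rewrite (le_trans (opnormP _ _)) ?ler_wpM2r. Qed.

Lemma enorm_split {R : realType} {k q} (x : 'cV[R]_(k + q)) :
  enorm x ^+ 2 = enorm (usubmx x) ^+ 2 + enorm (dsubmx x) ^+ 2.
Proof.
rewrite -!edotxx /edot big_split_ord /=.
by congr (_ + _); apply: eq_bigr => i _; rewrite !mxE.
Qed.

Lemma enorm_usub {R : realType} {k q} (x : 'cV[R]_(k + q)) :
  enorm (usubmx x) <= enorm x.
Proof.
apply: le_of_sqr => //; rewrite enorm_split lerDl sqr_ge0//.
Qed.

Lemma enorm_dsub {R : realType} {k q} (x : 'cV[R]_(k + q)) :
  enorm (dsubmx x) <= enorm x.
Proof.
apply: le_of_sqr => //; rewrite enorm_split lerDr sqr_ge0//.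
Qed.

Lemma enorm_le_split {R : realType} {k q} (x : 'cV[R]_(k + q)) :
  enorm x <= enorm (usubmx x) + enorm (dsubmx x).
Proof.
apply: le_of_sqr; first exact: addr_ge0.
rewrite enorm_split.
have := enorm_ge0 (usubmx x); have := enorm_ge0 (dsubmx x); nra.
Qed.

(** * Derivatives and the mean value inequality *)

Lemma scale_mulE {R : realType} (a b : R) : a *: b = a * b.
Proof. by []. Qed.

Lemma is_derive_mxP {R : realType} {m n} (M : R -> 'M[R]_(m, n)) (t : R) D :
  is_derive t 1 M D <->
  forall i j, is_derive t 1 (fun s => M s i j) (D i j).
Proof.
split=> [[dM <-] i j|h].
  have /derivable_mxP/(_ i j) dij := dM.
  by rewrite derive_mx// mxE; exact/derivableP.
have dM : derivable M t 1.
  by apply/derivable_mxP => i j; have [] := h i j.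
apply: DeriveDef => //; apply/matrixP => i j.
by rewrite derive_mx// mxE; have [_ ->] := h i j.
Qed.

Lemma is_derive_continuous {R : realType} {V : normedModType R} (f : R -> V) (t : R) D :
  is_derive t 1 f D -> {for t, continuous f}.
Proof.
by move=> [df _]; apply/differentiable_continuous/derivable1_diffP.
Qed.

Lemma is_derive_cmul {R : realType} (c : R) (f : R -> R) (t D : R) :
  is_derive t 1 f D -> is_derive t 1 (fun s => c * f s) (c * D).
Proof. exact: is_deriveZ. Qed.

Lemma is_derive_sub {R : realType} (f g : R -> R) (t D E : R) :
  is_derive t 1 f D -> is_derive t 1 g E ->
  is_derive t 1 (fun s => f s - g s) (D - E).
Proof. exact: is_deriveB. Qed.

Lemma is_derive_addc {R : realType} (c : R) (f : R -> R) (t D : R) :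
  is_derive t 1 f D -> is_derive t 1 (fun s => f s + c) D.
Proof.
move=> df; rewrite -[D]addr0.
exact: (is_deriveD df (is_derive_cst c t 1)).
Qed.

Lemma is_derive_mul {R : realType} (f g : R -> R) (t D E : R) :
  is_derive t 1 f D -> is_derive t 1 g E ->
  is_derive t 1 (fun s => f s * g s) (D * g t + f t * E).
Proof.
move=> df dg; apply: is_derive_eq (is_deriveM df dg) _.
by rewrite !scale_mulE; ring.
Qed.

Lemma is_derive_sqrt_comp {R : realType} (f : R -> R) (t D : R) :
  0 < f t -> is_derive t 1 f D ->
  is_derive t 1 (fun s => Num.sqrt (f s)) ((2 * Num.sqrt (f t))^-1 * D).
Proof.
move=> ft df.
exact: (@is_derive1_comp _ Num.sqrt f t _ _ (is_derive1_sqrt ft) df).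
Qed.

Lemma is_derive_expR_affine {R : realType} (c a t : R) :
  is_derive t 1 (fun s => expR (c * (s - a))) (c * expR (c * (t - a))).
Proof.
have e : is_derive t 1 (fun s => c * (s - a)) (c * (1 - 0)).
  exact: (is_derive_cmul _ _ _ _
    (is_derive_sub _ _ _ _ _ (is_derive_id t 1) (is_derive_cst a t 1))).
apply: is_derive_eq (is_derive1_comp (is_derive_expR _) e) _.
by rewrite subr0 mulr1 mulrC.
Qed.

Lemma continuous_expR_affine {R : realType} (c a : R) :
  continuous (fun s : R => expR (c * (s - a))).
Proof. by move=> t; apply: is_derive_continuous; exact: is_derive_expR_affine. Qed.

Lemma is_derive_bigsum {R : realType} {n} (f : 'I_n -> R -> R) (df : 'I_n -> R)
    (t : R) : (forall i, is_derive t 1 (f i) (df i)) ->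
  is_derive t 1 (fun s => \sum_(i < n) f i s) (\sum_(i < n) df i).
Proof.
move=> h; have -> : (fun s => \sum_(i < n) f i s) = \sum_(i < n) f i.
  by apply/funext => s; rewrite fct_sumE.
exact: is_derive_sum.
Qed.

Lemma is_derive_mulmx {R : realType} {m n p} (M : R -> 'M[R]_(m, n))
    (N : R -> 'M[R]_(n, p)) (t : R) M' N' :
  is_derive t 1 M M' -> is_derive t 1 N N' ->
  is_derive t 1 (fun s => M s *m N s) (M' *m N t + M t *m N').
Proof.
move=> /is_derive_mxP dM /is_derive_mxP dN; apply/is_derive_mxP => i j.
have -> : (fun s => (M s *m N s) i j) =
    (fun s => \sum_(k < n) (M s i k * N s k j)).
  by apply/funext => s; rewrite mxE.
rewrite !mxE -big_split /=.
have e k : is_derive t 1 (fun s => M s i k * N s k j)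
    (M' i k * N t k j + M t i k * N' k j).
  apply: is_derive_eq (is_deriveM (dM i k) (dN k j)) _.
  by rewrite !scale_mulE; ring.
exact: (is_derive_bigsum _ _ _ e).
Qed.

Lemma is_derive_usub {R : realType} {k q} (M : R -> 'cV[R]_(k + q)) (t : R) D :
  is_derive t 1 M D -> is_derive t 1 (fun s => usubmx (M s)) (usubmx D).
Proof.
move=> /is_derive_mxP h; apply/is_derive_mxP => i j; rewrite mxE.
have -> : (fun s => usubmx (M s) i j) = (fun s => M s (lshift q i) j).
  by apply/funext => s; rewrite mxE.
exact: h.
Qed.

Lemma is_derive_dsub {R : realType} {k q} (M : R -> 'cV[R]_(k + q)) (t : R) D :
  is_derive t 1 M D -> is_derive t 1 (fun s => dsubmx (M s)) (dsubmx D).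
Proof.
move=> /is_derive_mxP h; apply/is_derive_mxP => i j; rewrite mxE.
have -> : (fun s => dsubmx (M s) i j) = (fun s => M s (rshift k i) j).
  by apply/funext => s; rewrite mxE.
exact: h.
Qed.

Lemma is_derive_edot {R : realType} {n} (c : 'cV[R]_n) (d : R -> 'cV[R]_n) (t : R) D :
  is_derive t 1 d D -> is_derive t 1 (fun s => edot c (d s)) (edot c D).
Proof.
move=> /is_derive_mxP h.
have e i : is_derive t 1 (fun s => c i 0 * d s i 0) (c i 0 * D i 0).
  exact: (is_deriveZ (c i 0) (h i 0)).
exact: (is_derive_bigsum _ _ _ e).
Qed.

Lemma is_derive_edotxx {R : realType} {n} (d : R -> 'cV[R]_n) (t : R) D :
  is_derive t 1 d D ->
  is_derive t 1 (fun s => edot (d s) (d s)) (2 * edot (d t) D).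
Proof.
move=> /is_derive_mxP h; rewrite /edot mulr_sumr.
have e i : is_derive t 1 (fun s => d s i 0 * d s i 0) (2 * (d t i 0 * D i 0)).
  apply: is_derive_eq (is_deriveM (h i 0) (h i 0)) _.
  by rewrite !scale_mulE; ring.
exact: (is_derive_bigsum _ _ _ e).
Qed.

Lemma is_derive_oppr {R : realType} {m n} (M : R -> 'M[R]_(m, n)) (t : R) D :
  is_derive (- t) 1 M D -> is_derive t 1 (fun s => M (- s)) (- D).
Proof.
move=> /is_derive_mxP h; apply/is_derive_mxP => i j; rewrite mxE.
have := is_derive1_comp (h i j) (is_deriveNid t 1).
by rewrite mulrN1.
Qed.

(** * Limits and continuity of matrix-valued functions *)

Lemma cvg_mxP {R : realType} {T : Type} {F : set_system T} {FF : Filter F}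
    {m n} (M : T -> 'M[R]_(m, n)) (A : 'M[R]_(m, n)) :
  M @ F --> A <-> forall i j, (M x i j) @[x --> F] --> A i j.
Proof.
split=> [h i j|h].
  apply/cvgrPdist_le => /= e e0.
  move/cvgrPdist_le : h => /(_ _ e0); apply: filterS => x.
  by apply: le_trans; have := coord_le_norm (A - M x) i j; rewrite !mxE.
apply/cvgrPdist_le => /= e e0; near=> x.
rewrite /Num.Def.normr/= mx_normrE (bigmax_le _ (ltW e0))//= => i _.
rewrite !mxE/=; move: i; near: x; apply: filter_forall => /= i.
by have /cvgrPdist_le/(_ _ e0) := h i.1 i.2.
Unshelve. all: by end_near. Qed.

Lemma cvg_mulmx {R : realType} {T : Type} {F : set_system T} {FF : Filter F}
    {m n p} (M : T -> 'M[R]_(m, n)) (N : T -> 'M[R]_(n, p))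
    (A : 'M[R]_(m, n)) (B : 'M[R]_(n, p)) :
  M @ F --> A -> N @ F --> B -> (M x *m N x) @[x --> F] --> A *m B.
Proof.
move=> /cvg_mxP cM /cvg_mxP cN; apply/cvg_mxP => i j; rewrite mxE.
have -> : (fun s => (M s *m N s) i j) =
    (fun s => \sum_(k < n) (M s i k * N s k j)).
  by apply/funext => s; rewrite mxE.
apply: cvg_big => [|k _]; first exact: add_continuous.
by apply: cvgM; [exact: cM|exact: cN].
Qed.

Lemma continuous_mxP {R : realType} {T : topologicalType} {m n}
    (M : T -> 'M[R]_(m, n)) t :
  {for t, continuous M} <-> forall i j, {for t, continuous (fun s => M s i j)}.
Proof. exact: cvg_mxP. Qed.

Lemma continuous_mulmx {R : realType} {T : topologicalType} {m n p}
    (M : T -> 'M[R]_(m, n)) (N : T -> 'M[R]_(n, p)) t :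
  {for t, continuous M} -> {for t, continuous N} ->
  {for t, continuous (fun s => M s *m N s)}.
Proof. exact: cvg_mulmx. Qed.

Lemma continuous_edot {R : realType} {n} (c : 'cV[R]_n) (d : R -> 'cV[R]_n) t :
  {for t, continuous d} -> {for t, continuous (fun s => edot c (d s))}.
Proof.
move=> /continuous_mxP h.
apply: cvg_big => [|k _]; first exact: add_continuous.
by apply: cvgM; [exact: cvg_cst|exact: h].
Qed.

Lemma continuous_edotxx {R : realType} {n} (d : R -> 'cV[R]_n) t :
  {for t, continuous d} -> {for t, continuous (fun s => edot (d s) (d s))}.
Proof.
move=> /continuous_mxP h.
apply: cvg_big => [|k _]; first exact: add_continuous.
by apply: cvgM; exact: h.
Qed.

Lemma continuous_enorm {R : realType} {n} (d : R -> 'cV[R]_n) t :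
  {for t, continuous d} -> {for t, continuous (fun s => enorm (d s))}.
Proof.
move=> /continuous_mxP h.
apply: (@continuous_comp _ _ _ (fun s => \sum_(i < n) d s i 0 ^+ 2) Num.sqrt);
  last exact: sqrt_continuous.
apply: cvg_big => [|k _]; first exact: add_continuous.
by rewrite /=; apply: cvgM; exact: h.
Qed.

Lemma continuous_usub {R : realType} {k q} (M : R -> 'cV[R]_(k + q)) t :
  {for t, continuous M} -> {for t, continuous (fun s => usubmx (M s))}.
Proof.
move=> /continuous_mxP h; apply/continuous_mxP => i j.
have -> : (fun s => usubmx (M s) i j) = (fun s => M s (lshift q i) j).
  by apply/funext => s; rewrite mxE.
exact: h.
Qed.

Lemma continuous_dsub {R : realType} {k q} (M : R -> 'cV[R]_(k + q)) t :
  {for t, continuous M} -> {for t, continuous (fun s => dsubmx (M s))}.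
Proof.
move=> /continuous_mxP h; apply/continuous_mxP => i j.
have -> : (fun s => dsubmx (M s) i j) = (fun s => M s (rshift k i) j).
  by apply/funext => s; rewrite mxE.
exact: h.
Qed.

(** * Mean value and Gronwall inequalities *)

Lemma nondecreasing_segment {R : realType} (h : R -> R) (a b : R) : a <= b ->
  continuous h ->
  (forall x, a < x < b -> exists2 h', is_derive x 1 h h' & 0 <= h') ->
  h a <= h b.
Proof.
move=> ab ch dh.
apply: (@ger0_derive1_ndecr _ h a b) => // [x|x|].
- by rewrite in_itv/= => /dh[h' []].
- by rewrite in_itv/= => /dh[h' [dhx <-]]; rewrite derive1E.
- exact: continuous_subspaceT.
Qed.

(** Projecting [d] on the fixed direction [c = d b - d a] reduces the claim to monotonicity of the
    scalar function [enorm c * psi - edot c d]; a factor [enorm c] is then cancelled. *)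
Lemma vec_increment {R : realType} {n} (d : R -> 'cV[R]_n) (psi : R -> R) (a b : R) :
  a <= b -> continuous d -> continuous psi ->
  (forall x, a < x < b -> exists d' psi',
    [/\ is_derive x 1 d d', is_derive x 1 psi psi' & enorm d' <= psi']) ->
  enorm (d b - d a) <= psi b - psi a.
Proof.
move=> ab cd cpsi h.
set c := d b - d a.
have mono : edot c (d b - d a) <= enorm c * (psi b - psi a).
  suff : enorm c * psi a - edot c (d a) <= enorm c * psi b - edot c (d b).
    by rewrite edotBr mulrBr; lra.
  apply: (@nondecreasing_segment _
    (fun s => enorm c * psi s - edot c (d s)) a b) => // [x|x /h].
    apply: cvgB; first by apply: cvgM; [exact: cvg_cst|exact: cpsi].
    by apply: continuous_edot; exact: cd.
  move=> [d' [psi' [dd dpsi le]]].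
  exists (enorm c * psi' - edot c d').
    exact: (is_derive_sub _ _ _ _ _ (is_derive_cmul _ _ _ _ dpsi)
      (is_derive_edot _ _ _ _ dd)).
  by rewrite subr_ge0 (le_trans (edot_le _ _)) ?ler_wpM2l.
(* If [c] vanishes, it remains to see that [psi] does not decrease, which holds since [psi']
   dominates a norm. *)
have [c0|c0] := leP (enorm c) 0.
  rewrite (le_trans c0)// subr_ge0.
  apply: nondecreasing_segment => // x /h[d' [psi' [_ dpsi le]]].
  by exists psi' => //; rewrite (le_trans _ le).
by rewrite -(ler_pM2l c0) -expr2 -edotxx.
Qed.

(** With a regularised norm [rho] of [d], the function [G s - exp(-mu (s - a)) rho s] is
    nondecreasing. Comparing the end points gives the bound up to [eta], which is then sent to 0. *)
Lemma gronwall {R : realType} {n} (d : R -> 'cV[R]_n) (mu G a b : R) :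
  0 <= G -> 0 <= mu -> a <= b -> continuous d ->
  (forall x, a < x < b -> exists2 d', is_derive x 1 d d' &
    enorm d' <= mu * enorm (d x) + G) ->
  enorm (d b) <= expR (mu * (b - a)) * (enorm (d a) + G * (b - a)).
Proof.
move=> G0 mu0 ab cd h.
suff main eta : 0 < eta ->
    enorm (d b) <= expR (mu * (b - a)) * (enorm (d a) + eta + G * (b - a)).
  apply/ler_addgt0Pr => e e0.
  rewrite (le_trans (main (e / expR (mu * (b - a))) _))//.
    by rewrite divr_gt0 ?expR_gt0.
  rewrite addrAC mulrDr lerD2l mulrCA divff ?mulr1// gt_eqF// expR_gt0//.
(* the regularised norm is differentiable even where [d] vanishes *)
move=> eta0; pose rho s := Num.sqrt (edot (d s) (d s) + eta ^+ 2).
have pos s : 0 < edot (d s) (d s) + eta ^+ 2.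
  by rewrite edotxx ltr_wpDl ?sqr_ge0// exprn_gt0.
have rho0 s : 0 < rho s by rewrite sqrtr_gt0.
have rhoE s : rho s ^+ 2 = enorm (d s) ^+ 2 + eta ^+ 2.
  by rewrite sqr_sqrtr ?ltW// edotxx.
have le_rho s : enorm (d s) <= rho s.
  apply: le_of_sqr; first exact: ltW.
  rewrite rhoE lerDl sqr_ge0//.
pose H s := G * s - expR (- mu * (s - a)) * rho s.
have Hab : H a <= H b.
  apply: nondecreasing_segment => // [x|x xab].
    apply: cvgB; first by apply: cvgM; [exact: cvg_cst|exact: cvg_id].
    apply: cvgM; first exact: continuous_expR_affine.
    apply: (@continuous_comp _ _ _ (fun s => edot (d s) (d s) + eta ^+ 2)
      Num.sqrt); last exact: sqrt_continuous.
    apply: cvgD; last exact: cvg_cst.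
    by apply: continuous_edotxx; exact: cd.
  have [d' dd le] := h _ xab.
  have drho : is_derive x 1 rho ((2 * rho x)^-1 * (2 * edot (d x) d')).
    have e1 : is_derive x 1 (fun s => edot (d s) (d s) + eta ^+ 2)
        (2 * edot (d x) d').
      exact: (is_derive_addc _ _ _ _ (is_derive_edotxx _ _ _ dd)).
    exact: (is_derive_sqrt_comp (fun s => edot (d s) (d s) + eta ^+ 2) _ _
      (pos x) e1).
  exists (G * 1 - ((- mu * expR (- mu * (x - a))) * rho x +
      expR (- mu * (x - a)) * ((2 * rho x)^-1 * (2 * edot (d x) d')))).
    exact: (is_derive_sub _ _ _ _ _ (is_derive_cmul _ _ _ _ (is_derive_id x 1))
      (is_derive_mul _ _ _ _ _ (is_derive_expR_affine _ _ _) drho)).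
  set E := expR _; have E0 : 0 < E by exact: expR_gt0.
  have E1 : E <= 1.
    rewrite -expR0 ler_expR mulNr oppr_le0 mulr_ge0// subr_ge0.
    by case/andP: xab => /ltW.
  have -> : (2 * rho x)^-1 * (2 * edot (d x) d') = edot (d x) d' / rho x.
    by field; rewrite gt_eqF.
  have r' : edot (d x) d' / rho x <= mu * rho x + G.
    rewrite ler_pdivrMr// (le_trans (edot_le _ _))// mulrC ler_pM//.
    by rewrite (le_trans le)// lerD2r ler_wpM2l.
  have := rho0 x; nra.
have : expR (- mu * (b - a)) * rho b <= rho a + G * (b - a).
  move: Hab; rewrite /H subrr mulr0 expR0; lra.
rewrite mulNr expRN mulrC ler_pdivrMr ?expR_gt0// mulrC => hb.
rewrite (le_trans (le_rho b))// (le_trans hb)// ler_pM2l ?expR_gt0// lerD2r.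
apply: le_of_sqr; first by apply: addr_ge0 => //; exact: ltW.
rewrite rhoE.
have := enorm_ge0 (d a); nra.
Qed.

(** The hypothesis bounds only the norm of the derivative, so it survives the time reversal
    [s |-> - s]. *)
Lemma gronwall_bwd {R : realType} {n} (d : R -> 'cV[R]_n) (mu G a b : R) :
  0 <= G -> 0 <= mu -> a <= b -> continuous d ->
  (forall x, a < x < b -> exists2 d', is_derive x 1 d d' &
    enorm d' <= mu * enorm (d x) + G) ->
  enorm (d a) <= expR (mu * (b - a)) * (enorm (d b) + G * (b - a)).
Proof.
move=> G0 mu0 ab cd h.
have := @gronwall _ _ (fun s => d (- s)) mu G (- b) (- a) G0 mu0.
rewrite !opprK lerN2 => /(_ ab); rewrite [- a + b]addrC; apply.
  by move=> x; apply: continuous_comp; [exact: opp_continuous|exact: cd].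
move=> x /andP[bx xa]; have /h[d' dd le] : a < - x < b.
  by rewrite ltrNr xa ltrNl bx.
by exists (- d'); [exact: is_derive_oppr|rewrite enormN].
Qed.

(** * Transition matrices *)

Lemma is_derive_cvg {R : realType} {V : normedModType R} (f : R -> V) (s : R) (D : V) :
  (fun h : R => h^-1 *: (f (h + s) - f s)) @ 0^' --> D -> is_derive s 1 f D.
Proof.
move=> h; have {}h : (fun h : R => h^-1 *: (f (h *: 1 + s) - f s)) @ 0^' --> D.
  have -> : (fun h : R => h^-1 *: (f (h *: 1 + s) - f s)) =
      (fun h : R => h^-1 *: (f (h + s) - f s)).
    by apply/funext => x; rewrite [_%:A]mulr1.
  exact: h.
by apply: DeriveDef; [exact: cvgP h|exact: cvg_lim h].
Qed.

Lemma is_derive_cvgE {R : realType} {V : normedModType R} (f : R -> V) (s : R) (D : V) :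
  is_derive s 1 f D -> (fun h : R => h^-1 *: (f (h + s) - f s)) @ 0^' --> D.
Proof.
move=> [df <-].
have -> : (fun h : R => h^-1 *: (f (h + s) - f s)) =
    (fun h : R => h^-1 *: (f (h *: 1 + s) - f s)).
  by apply/funext => x; rewrite [_%:A]mulr1.
exact: df.
Qed.

Lemma mulmx_ext {R : realType} {m n} (A B : 'M[R]_(m, n)) :
  (forall x : 'cV_n, A *m x = B *m x) -> A = B.
Proof.
move=> h; apply/matrixP => i j.
have := congr1 (fun v : 'cV[R]_m => v i 0) (h (delta_mx j 0)).
by rewrite -!colE !mxE.
Qed.

Lemma is_derive_mulmxc {R : realType} {n} (M : R -> 'M[R]_n) (x : 'cV[R]_n)
    (t : R) (D : 'M[R]_n) :
  is_derive t 1 M D -> is_derive t 1 (fun s => M s *m x) (D *m x).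
Proof.
move=> dM; have := is_derive_mulmx _ _ _ _ _ dM (is_derive_cst x t 1).
by rewrite mulmx0 addr0.
Qed.

Section transition.
Context {R : realType} {n : nat} (B : R -> 'M[R]_n) (U : R -> R -> 'M[R]_n).
Context (C : R).
Hypotheses (C0 : 0 <= C) (BC : forall t (x : 'cV[R]_n),
  enorm (B t *m x) <= C * enorm x).
Hypothesis tU : transition_matrix B U.

(** Gronwall in both time directions. For [x s = 0] this is uniqueness for the linear equation, from
    which the cocycle property follows. *)
Lemma linear_growth (x : R -> 'cV[R]_n) (s t : R) :
  (forall r : R, is_derive r 1 x (B r *m x r)) ->
  enorm (x t) <= expR (C * `|t - s|) * enorm (x s).
Proof.
move=> dx; have cx : continuous x.
  by move=> r; exact: is_derive_continuous (dx r).
have h (r : R) : exists2 d', is_derive r 1 x d' & enorm d' <= C * enorm (x r) + 0.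
  by exists (B r *m x r) => //; rewrite addr0.
have [st|/ltW ts] := leP s t.
  have := gronwall x C 0 s t (lexx _) C0 st cx (fun r _ => h r).
  by rewrite mul0r addr0 ger0_norm ?subr_ge0.
have := gronwall_bwd x C 0 t s (lexx _) C0 ts cx (fun r _ => h r).
by rewrite mul0r addr0 distrC ger0_norm ?subr_ge0.
Qed.

Lemma is_derive_transition (s t : R) (x : 'cV[R]_n) :
  is_derive t 1 (fun r => U r s *m x) (B t *m (U t s *m x)).
Proof.
by rewrite mulmxA; apply: is_derive_mulmxc; have [_] := tU s.
Qed.

Lemma transition_growth (t s : R) (x : 'cV[R]_n) :
  enorm (U t s *m x) <= expR (C * `|t - s|) * enorm x.
Proof.
have := linear_growth (fun r => U r s *m x) s t.
have [-> _] := tU s; rewrite mul1mx; apply => r.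
exact: is_derive_transition.
Qed.

Lemma transition_cocycle (t s r : R) : U t s *m U s r = U t r.
Proof.
apply: mulmx_ext => x; apply/eqP; rewrite -subr_eq0; apply/eqP/enorm_le0.
have := linear_growth (fun v => U v s *m U s r *m x - U v r *m x) s t.
have [-> _] := tU s; rewrite mul1mx subrr enorm0 mulr0; apply => v.
rewrite mulmxBr -mulmxA.
have -> : (fun v => U v s *m U s r *m x - U v r *m x) =
    (fun v => U v s *m (U s r *m x)) - (fun v => U v r *m x).
  by apply/funext => w; rewrite -mulmxA.
by apply: is_deriveB; exact: is_derive_transition.
Qed.

(** [transition_matrix] speaks about the first time argument only. Continuity in the second follows
    from [U t s - U t r = - U t r (1 - U r s)]: the last factor tends to 0 as [r] tends to [s], and
    [U t r] stays bounded. *)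
Lemma transition_continuousr (t s : R) : {for s, continuous (U t)}.
Proof.
have cU : {for s, continuous (U^~ s)}.
  by have [_ /(_ s)/is_derive_continuous] := tU s.
apply/cvg_mxP => i j; apply/cvgrPdist_le => /= e e0.
pose y r := (1%:M - U r s) *m (delta_mx j 0 : 'cV[R]_n).
(* [M] bounds the norm of [U t r] for all [r] at distance at most 1 from [s]. *)
pose M := expR (C * (`|t - s| + 1)).
have M0 : 0 < M by exact: expR_gt0.
have cy : (enorm (y r)) @[r --> s] --> (0 : R).
  have -> : 0 = enorm (y s).
    by rewrite /y; have [-> _] := tU s; rewrite subrr mul0mx enorm0.
  apply: continuous_enorm; apply: continuous_mulmx; last exact: cvg_cst.
  by apply: cvgB; [exact: cvg_cst|exact: cU].
near=> r.
have -> : U t s i j - U t r i j = - (U t r *m y r) i 0.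
  rewrite /y mulmxA mulmxBr mulmx1 transition_cocycle -colE !mxE.
  by rewrite opprB.
rewrite normrN (le_trans (coord_le_enorm _ _))//.
rewrite (le_trans (transition_growth _ _ _))//.
rewrite (@le_trans _ _ (M * (e / M)))//; last by rewrite mulrCA divff ?gt_eqF ?mulr1.
rewrite ler_pM ?expR_ge0//.
  rewrite ler_expR ler_wpM2l// (_ : t - r = t - s + (s - r)); last by ring.
  rewrite (le_trans (ler_normD _ _))// lerD2l.
  near: r; have : (fun r : R => r) @ s --> s by exact: cvg_id.
  by move=> /cvgrPdist_le/(_ 1 ltr01).
near: r; move/cvgrPdist_le : cy => /(_ (e / M)).
rewrite divr_gt0// => /(_ isT); apply: filterS => r.
by rewrite sub0r normrN ger0_norm.
Unshelve. all: by end_near. Qed.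

(** By the cocycle property the increment of [U t] from [s] to [s + h] is [- U t (h + s)] times the
    increment of [U ^~ s] at [s], whose derivative is known. *)
Lemma is_derive_transitionr (t s : R) :
  is_derive s 1 (U t) (- (U t s *m B s)).
Proof.
apply: is_derive_cvg.
have -> : (fun h => h^-1 *: (U t (h + s) - U t s)) =
    (fun h => - U t (h + s) *m (h^-1 *: (U (h + s) s - U s s))).
  apply/funext => h; have [-> _] := tU s.
  rewrite -scalemxAr mulmxBr mulmx1 !mulNmx transition_cocycle.
  by rewrite opprK addrC.
rewrite -mulNmx; apply: cvg_mulmx; last first.
  have [US /(_ s)] := tU s; rewrite {1}US mulmx1.
  exact: (is_derive_cvgE (U^~ s)).
apply: cvgN; apply: (@cvg_comp _ _ _ (fun h : R => h + s) (U t) _ (nbhs s)).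
  have : (fun h : R => h + s) @ 0^' --> 0 + s.
    apply: cvgD; last exact: cvg_cst.
    by apply: cvg_within_filter; exact: cvg_id.
  by rewrite add0r.
exact: transition_continuousr.
Qed.

End transition.

(** * Switching times *)

Section switching.
Context {R : realType} (th : R) (theta : int -> R) (beta : R -> R).
Hypotheses (sw : switching_times th theta) (be : is_beta theta beta).

Lemma switching_mono (i : int) (n : nat) : theta i <= theta (i + n%:Z).
Proof.
have [inc _ _] := sw; elim: n => [|n IH]; first by rewrite addr0.
by rewrite (le_trans IH)// -addn1 PoszD addrA ltW.
Qed.

Lemma switching_monoz (i j : int) : i <= j -> theta i <= theta j.
Proof.
move=> ij; have -> : j = i + `|j - i|%N%:Z by lia.
exact: switching_mono.
Qed.

(** The definition gives only that [|theta i|] is large. Monotonicity excludes a large negative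
    value to the right of [theta i]; the term [|theta i| + 1] in the threshold produces the
    contradiction. *)
Lemma switching_above (i : int) (C : R) : exists n : nat, C <= theta (i + n%:Z).
Proof.
have [_ /(_ (Num.max C (`|theta i| + 1)))[N hN] _] := sw.
exists (N + absz i)%N.
have /hN : (N <= absz (i + (N + absz i)%N%:Z)%R)%N by lia.
set x := theta (i + _); have : theta i <= x by exact: switching_mono.
have := ler_norm (- theta i); rewrite normrN => h1 h2.
rewrite ge_max => /andP[h3 h4]; have [x0|x0] := leP 0 x.
  by rewrite (ger0_norm x0) in h3.
by rewrite (ltr0_norm x0) in h4; lra.
Qed.

Lemma switching_below (C : R) : exists i, theta i <= C.
Proof.
have [_ /(_ (Num.max (1 - C) (`|theta 0| + 1)))[N hN] _] := sw.
exists (- N%:Z).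
have /hN : (N <= absz (- N%:Z)%R)%N by lia.
set x := theta (- _); have : x <= theta 0 by apply: switching_monoz; lia.
have := ler_norm (theta 0) => h1 h2.
rewrite ge_max => /andP[h3 h4]; have [x0|x0] := leP 0 x.
  by rewrite (ger0_norm x0) in h4; lra.
by rewrite (ltr0_norm x0) in h3; lra.
Qed.

Lemma switching_floor (t : R) : exists i, theta i <= t < theta (i + 1).
Proof.
have [i0 h0] := switching_below t.
have ex : exists n : nat, t < theta (i0 + n%:Z).
  have [n hn] := switching_above i0 (t + 1); exists n; lra.
case: (ex_minnP ex) => -[|n] h1 h2; first by rewrite addr0 in h1; lra.
exists (i0 + n%:Z); rewrite -addrA -PoszD addn1 h1 andbT leNgt.
by apply/negP => /h2; rewrite ltnn.
Qed.

(** Glues estimates across switching times, where solutions need not be differentiable. The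
    induction is on the number of intervals after [theta i] needed to reach [b]. *)
Lemma switching_chain (i : int) (Inc : R -> R -> Prop) :
  (forall a b c, Inc a b -> Inc b c -> Inc a c) ->
  (forall j a b, i <= j -> theta j <= a -> a <= b -> b <= theta (j + 1) ->
    Inc a b) ->
  forall a b, theta i <= a -> a <= b -> Inc a b.
Proof.
move=> tr base a b ia ab; have [n hn] := switching_above i b.
elim: n a b ia ab hn => [|n IH] a b ia ab hn.
  rewrite addr0 in hn; apply: (base i) => //.
  by rewrite (le_trans hn)//; have [/(_ i)/ltW] := sw.
have ij : i <= i + n%:Z by lia.
have e1 : i + n.+1%:Z = i + n%:Z + 1 by lia.
have [bl|bl] := leP b (theta (i + n%:Z)); first exact: IH.
have [al|al] := leP a (theta (i + n%:Z)); last first.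
  by apply: (base (i + n%:Z)) => //; [exact: ltW|rewrite -e1].
apply: (tr _ (theta (i + n%:Z))); first exact: IH.
by apply: (base (i + n%:Z)) => //; [exact: ltW|rewrite -e1].
Qed.

Lemma vec_increment_switch {n} (i : int) (d : R -> 'cV[R]_n) (psi : R -> R) (a b : R) :
  theta i <= a -> a <= b -> continuous d -> continuous psi ->
  (forall j x, i <= j -> theta j < x < theta (j + 1) -> a < x < b ->
    exists d' psi',
    [/\ is_derive x 1 d d', is_derive x 1 psi psi' & enorm d' <= psi']) ->
  enorm (d b - d a) <= psi b - psi a.
Proof.
move=> ia ab cd cpsi h.
suff [_] : a <= b /\ (a <= a -> b <= b -> enorm (d b - d a) <= psi b - psi a).
  exact.
(* The gluing lemma ranges over all pairs of end points, so the relation carries their order and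
   claims the estimate only inside [[a, b]]. *)
apply: (switching_chain i (fun x y => x <= y /\
  (a <= x -> y <= b -> enorm (d y - d x) <= psi y - psi x))) => //.
  move=> x y z [xy h1] [yz h2]; split; first exact: le_trans yz.
  move=> ax zb; rewrite (_ : d z - d x = (d z - d y) + (d y - d x)); last first.
    by rewrite addrA subrK.
  have := h1 ax (le_trans yz zb); have := h2 (le_trans ax xy) zb.
  have := enormD (d z - d y) (d y - d x); lra.
move=> j x y ij jx xy yj; split=> // ax yb.
apply: vec_increment => // r /andP[xr ry]; apply: (h j) => //.
  by rewrite (le_lt_trans jx xr) (lt_le_trans ry yj).
by rewrite (le_lt_trans ax xr) (lt_le_trans ry yb).
Qed.

(** The retarded argument stays in [[theta i, +oo)], where decay is assumed, and lags by at most
    [th], which costs a factor [exp(alpha th)] in the estimates below. *)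
Lemma beta_bounds (i j : int) (t : R) : i <= j -> theta j <= t < theta (j + 1) ->
  theta i <= beta t <= t /\ t <= beta t + th.
Proof.
move=> ij jt; rewrite (be j t jt); have /andP[j1 j2] := jt.
rewrite switching_monoz// j1; split=> //.
by have [_ _ /(_ j)] := sw; lra.
Qed.

End switching.

(** * Decaying solutions of the perturbed linear system *)

Section dichotomy_bounds.
Context {R : realType} {n : nat} (th : R) (theta : int -> R) (i : int).
Context (B : R -> 'M[R]_n) (U : R -> R -> 'M[R]_n) (C K sigma alpha E : R).
Hypotheses (sw : switching_times th theta) (C0 : 0 <= C)
  (BC : forall t (x : 'cV[R]_n), enorm (B t *m x) <= C * enorm x)
  (tU : transition_matrix B U) (K0 : 0 < K) (alpha0 : 0 < alpha)
  (alpha_lt : alpha < sigma) (E0 : 0 <= E).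
Context (u : R -> 'cV[R]_n).
Hypotheses (cu : continuous u) (du : forall (j : int) (s : R), i <= j ->
  theta j < s < theta (j + 1) ->
  exists2 e, is_derive s 1 u (B s *m u s + e) &
    enorm e <= E * expR (- alpha * (s - theta i))).

(** The terms with [B] cancel in the derivative of [U t s *m u s] with respect to [s], leaving
    [U t s *m e]; its norm is dominated by the derivative of the comparison function [psi]. *)
Lemma variation_of_constants (t : R) (psi : R -> R) (a b : R) :
  theta i <= a -> a <= b -> continuous psi ->
  (forall s, a < s < b -> exists2 psi', is_derive s 1 psi psi' &
    forall e, enorm e <= E * expR (- alpha * (s - theta i)) ->
      enorm (U t s *m e) <= psi') ->
  enorm (U t b *m u b - U t a *m u a) <= psi b - psi a.
Proof.
move=> ia ab cpsi h.
apply: (vec_increment_switch _ _ sw i (fun s => U t s *m u s) psi) => //.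
  move=> s; apply: continuous_mulmx; last exact: cu.
  exact: (transition_continuousr B U C).
move=> j s ij js /h[psi' dpsi le]; have [e de ee] := du j s ij js.
exists (U t s *m e), psi'; split=> //; last exact: le.
have := is_derive_mulmx _ _ _ _ _
  (is_derive_transitionr B U C C0 BC tU t s) de.
by rewrite mulmxDr mulNmx mulmxA addKr.
Qed.

Lemma forward_bound :
  (forall t s (x : 'cV[R]_n), s <= t ->
    enorm (U t s *m x) <= K * expR (- sigma * (t - s)) * enorm x) ->
  forall t, theta i <= t -> enorm (u t) <=
    (K * enorm (u (theta i)) + K * E / (sigma - alpha))
      * expR (- alpha * (t - theta i)).
Proof.
move=> UK t it; have sa : 0 < sigma - alpha by rewrite subr_gt0.
(* With this [c], the derivative of [c exp((sigma - alpha) (s - theta i))] is exactly the bound [K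
   exp(-sigma (t - s)) E exp(-alpha (s - theta i))] of the integrand. *)
pose c := K * E / (sigma - alpha) * expR (- sigma * (t - theta i)).
have c0 : 0 <= c by rewrite mulr_ge0 ?expR_ge0// divr_ge0 ?mulr_ge0// ltW.
have h : enorm (U t t *m u t - U t (theta i) *m u (theta i)) <=
    c * expR ((sigma - alpha) * (t - theta i)) -
    c * expR ((sigma - alpha) * (theta i - theta i)).
  apply: (variation_of_constants t
    (fun s => c * expR ((sigma - alpha) * (s - theta i)))) => //.
  by move=> s; apply: cvgM; [exact: cvg_cst|exact: continuous_expR_affine].
  move=> s /andP[s1 s2]; eexists.
    exact: (is_derive_cmul _ _ _ _ (is_derive_expR_affine _ _ _)).
  move=> e ee; rewrite (le_trans (UK _ _ _ (ltW s2)))//.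
  apply: (le_trans (ler_wpM2l _ ee)).
    by rewrite mulr_ge0 ?expR_ge0// ltW.
  rewrite le_eqVlt; apply/orP; left; apply/eqP.
  have -> : K * expR (- sigma * (t - s)) * (E * expR (- alpha * (s - theta i)))
      = K * E * (expR (- sigma * (t - s)) * expR (- alpha * (s - theta i))).
    by ring.
  have -> : c * ((sigma - alpha) * expR ((sigma - alpha) * (s - theta i)))
     = K * E * (expR (- sigma * (t - theta i)) *
        expR ((sigma - alpha) * (s - theta i))).
    by rewrite /c; field; rewrite gt_eqF.
  by rewrite -!expRD; congr (_ * expR _); ring.
move: h; have [-> _] := tU t; rewrite mul1mx subrr mulr0 expR0 mulr1.
have -> : c * expR ((sigma - alpha) * (t - theta i)) =
    K * E / (sigma - alpha) * expR (- alpha * (t - theta i)).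
  by rewrite /c -mulrA -expRD; congr (_ * expR _); ring.
move=> h; have := UK t (theta i) (u (theta i)) it.
have e1 : expR (- sigma * (t - theta i)) <= expR (- alpha * (t - theta i)).
  by rewrite ler_expR ler_wpM2r ?subr_ge0// lerN2 ltW.
have := enormD (u t - U t (theta i) *m u (theta i)) (U t (theta i) *m u (theta i)).
rewrite subrK.
have e2 : K * expR (- sigma * (t - theta i)) * enorm (u (theta i)) <=
    K * enorm (u (theta i)) * expR (- alpha * (t - theta i)).
  by rewrite mulrAC ler_wpM2l// mulr_ge0// ltW.
rewrite mulrDl; lra.
Qed.

(** The value at [t] is compared with the one at a late time [T]. Backward decay of [U t T] and
    boundedness of [u] make the contribution of [u T] arbitrarily small, so no initial value enters
    the bound. *)
Lemma backward_bound N0 :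
  (forall t s (x : 'cV[R]_n), t <= s ->
    enorm (U t s *m x) <= K * expR (- sigma * (s - t)) * enorm x) ->
  (forall t, theta i <= t -> enorm (u t) <= N0) ->
  forall t, theta i <= t -> enorm (u t) <=
    K * E / (sigma + alpha) * expR (- alpha * (t - theta i)).
Proof.
move=> UK uN t it; have s0 : 0 < sigma by exact: lt_trans alpha_lt.
have sa : 0 < sigma + alpha by rewrite addr_gt0.
have N00 : 0 <= N0 by rewrite (le_trans _ (uN t it)).
pose c := K * E / (sigma + alpha) * expR (sigma * (t - theta i)).
have c0 : 0 <= c by rewrite mulr_ge0 ?expR_ge0// divr_ge0 ?mulr_ge0// ltW.
apply/ler_addgt0Pr => eps eps0.
(* Chosen so that [exp(sigma (T - t))], which is at least [1 + sigma (T - t)], exceeds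
   [K N0 / eps]. *)
pose T := t + K * N0 / (sigma * eps).
have tT : t <= T.
  by rewrite /T lerDl divr_ge0// mulr_ge0// ltW.
have iT : theta i <= T by exact: le_trans tT.
have h : enorm (U t T *m u T - U t t *m u t) <=
    - c * expR (- (sigma + alpha) * (T - theta i)) -
    - c * expR (- (sigma + alpha) * (t - theta i)).
  apply: (variation_of_constants t
    (fun s => - c * expR (- (sigma + alpha) * (s - theta i)))) => //.
  by move=> s; apply: cvgM; [exact: cvg_cst|exact: continuous_expR_affine].
  move=> s /andP[s1 s2]; eexists.
    exact: (is_derive_cmul _ _ _ _ (is_derive_expR_affine _ _ _)).
  move=> e ee; rewrite (le_trans (UK _ _ _ (ltW s1)))//.
  apply: (le_trans (ler_wpM2l _ ee)).
    by rewrite mulr_ge0 ?expR_ge0// ltW.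
  rewrite le_eqVlt; apply/orP; left; apply/eqP.
  have -> : K * expR (- sigma * (s - t)) * (E * expR (- alpha * (s - theta i)))
      = K * E * (expR (- sigma * (s - t)) * expR (- alpha * (s - theta i))).
    by ring.
  have -> : - c * (- (sigma + alpha) * expR (- (sigma + alpha) * (s - theta i)))
     = K * E * (expR (sigma * (t - theta i)) *
        expR (- (sigma + alpha) * (s - theta i))).
    by rewrite /c; field; rewrite gt_eqF.
  by rewrite -!expRD; congr (_ * expR _); ring.
move: h; have [-> _] := tU t; rewrite mul1mx.
have -> : - c * expR (- (sigma + alpha) * (t - theta i)) =
    - (K * E / (sigma + alpha) * expR (- alpha * (t - theta i))).
  have -> : expR (- alpha * (t - theta i)) = expR (sigma * (t - theta i)) *
      expR (- (sigma + alpha) * (t - theta i)).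
    by rewrite -expRD; congr expR; ring.
  by rewrite /c; ring.
have := mulr_ge0 c0 (expR_ge0 (- (sigma + alpha) * (T - theta i))).
have := UK t T (u T) tT.
have eT : K * expR (- sigma * (T - t)) * enorm (u T) <= eps.
  rewrite (@le_trans _ _ (K * expR (- sigma * (T - t)) * N0))//.
    by rewrite ler_wpM2l ?uN// mulr_ge0 ?expR_ge0// ltW.
  rewrite mulNr expRN mulrAC ler_pdivrMr ?expR_gt0//.
  have : 1 + sigma * (T - t) <= expR (sigma * (T - t)) by exact: expR_ge1Dx.
  have -> : sigma * (T - t) = K * N0 / eps.
    by rewrite /T addrAC subrr add0r; field; rewrite !gt_eqF.
  rewrite -ler_pdivrMl// => h; rewrite mulrC (le_trans _ h)// lerDr//.
have := enormD (U t T *m u T) (u t - U t T *m u T).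
rewrite addrC subrK [enorm (u t - _)]enormBC; lra.
Qed.

End dichotomy_bounds.

(** Bootstrap: the two dichotomy bounds and the smallness of [L] improve any decay constant [N] of
    [Y] to [c + N / 2], with [c = K * enorm (usubmx (Y tau)) + D * eta]. The best constant therefore
    is at most [2 c]; the a priori constant [N0] ensures that it is finite. *)
Lemma key_estimate {R : realType} {k q : nat} (th : R) (theta : int -> R)
    (beta : R -> R) (i : int) (Bp : R -> 'M[R]_k) (Bm : R -> 'M[R]_q)
    (U : R -> R -> 'M[R]_k) (V : R -> R -> 'M[R]_q) (C K sigma alpha L eta N0 : R)
    (Y : R -> 'cV[R]_(k + q)) :
  let tau := theta i in
  let D := K * ((sigma - alpha)^-1 + (sigma + alpha)^-1) in
  switching_times th theta -> is_beta theta beta ->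
  0 <= C ->
  (forall t x, enorm (Bp t *m x) <= C * enorm x) ->
  (forall t x, enorm (Bm t *m x) <= C * enorm x) ->
  transition_matrix Bp U -> transition_matrix Bm V ->
  0 < K -> 0 < alpha < sigma ->
  (forall t s x, s <= t ->
    enorm (U t s *m x) <= K * expR (- sigma * (t - s)) * enorm x) ->
  (forall t s x, t <= s ->
    enorm (V t s *m x) <= K * expR (- sigma * (s - t)) * enorm x) ->
  0 <= L -> L * (1 + expR (alpha * th)) * D <= 2^-1 -> 0 <= eta ->
  continuous Y ->
  (forall (j : int) (s : R), i <= j -> theta j < s < theta (j + 1) ->
    exists ep em, [/\
      is_derive s 1 Y (col_mx (Bp s *m usubmx (Y s) + ep)
        (Bm s *m dsubmx (Y s) + em)),
      enorm ep <= L * (enorm (Y s) + enorm (Y (beta s)))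
        + eta * expR (- alpha * (s - tau))
    & enorm em <= L * (enorm (Y s) + enorm (Y (beta s)))
        + eta * expR (- alpha * (s - tau))]) ->
  (forall t, tau <= t -> enorm (Y t) <= N0 * expR (- alpha * (t - tau))) ->
  forall t, tau <= t ->
    enorm (Y t) <= 2 * (K * enorm (usubmx (Y tau)) + D * eta)
      * expR (- alpha * (t - tau)).
Proof.
move=> tau D sw be C0 BpC BmC tU tV K0 /andP[a0 as'] UK VK L0 LD eta0 cY dY YN.
have sma : 0 < sigma - alpha by rewrite subr_gt0.
have spa : 0 < sigma + alpha by lra.
have D0 : 0 < D by rewrite mulr_gt0// addr_gt0// invr_gt0.
pose c := K * enorm (usubmx (Y tau)) + D * eta.
have improve N : 0 <= N ->
    (forall t, tau <= t -> enorm (Y t) <= N * expR (- alpha * (t - tau))) ->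
    forall t, tau <= t ->
      enorm (Y t) <= (c + 2^-1 * N) * expR (- alpha * (t - tau)).
  move=> N00 hN t it.
  (* [E] collects the whole error at rate [alpha]: the retarded value [Y (beta s)] contributes
     [exp(alpha th)] times the bound on the current one. *)
  pose E := L * (1 + expR (alpha * th)) * N + eta.
  have E0 : 0 <= E by rewrite addr_ge0// !mulr_ge0// addr_ge0// expR_ge0.
  have errE (j : int) (s : R) : i <= j -> theta j < s < theta (j + 1) ->
      L * (enorm (Y s) + enorm (Y (beta s))) + eta * expR (- alpha * (s - tau))
      <= E * expR (- alpha * (s - tau)).
    move=> ij js.
    have js' : theta j <= s < theta (j + 1).
      by case/andP: js => /ltW -> ->.
    have [/andP[b1 b2] b3] := beta_bounds _ _ _ sw be i j s ij js'.
    have h1 := hN s (le_trans b1 b2); have h2 := hN _ b1.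
    have h3 : expR (- alpha * (beta s - tau)) <=
        expR (alpha * th) * expR (- alpha * (s - tau)).
      rewrite -expRD ler_expR -subr_ge0.
      rewrite (_ : _ - _ = alpha * (beta s + th - s)); last by ring.
      by rewrite mulr_ge0 ?(ltW a0)// subr_ge0.
    have h4 := ler_wpM2l N00 h3.
    have h5 : enorm (Y s) + enorm (Y (beta s)) <=
        (1 + expR (alpha * th)) * N * expR (- alpha * (s - tau)).
      rewrite mulrDl mul1r mulrDl; lra.
    rewrite /E mulrDl lerD2r -!mulrA ler_wpM2l// mulrA//.
  have hu := forward_bound th theta i Bp U C K sigma alpha E sw C0 BpC tU K0
    as' E0 (fun s => usubmx (Y s)).
  have hv := backward_bound th theta i Bm V C K sigma alpha E sw C0 BmC tV K0
    a0 as' E0 (fun s => dsubmx (Y s)).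
  have {}hu := hu _ _ UK t it.
  have {}hv := hv _ _ N VK _ t it.
  rewrite (le_trans (enorm_le_split _))//.
  have {}hu : enorm (usubmx (Y t)) <=
     (K * enorm (usubmx (Y tau)) + K * E / (sigma - alpha))
      * expR (- alpha * (t - tau)).
    apply: hu.
      by move=> s; apply: continuous_usub; exact: cY.
    move=> j s ij js; have [ep [em [dYs he _]]] := dY j s ij js.
    exists ep; last exact: le_trans (errE _ _ ij js).
    by have := is_derive_usub _ _ _ dYs; rewrite col_mxKu.
  have {}hv : enorm (dsubmx (Y t)) <=
     K * E / (sigma + alpha) * expR (- alpha * (t - tau)).
    apply: hv.
    - by move=> s; apply: continuous_dsub; exact: cY.
    - move=> j s ij js; have [ep [em [dYs _ he]]] := dY j s ij js.
      exists em; last exact: le_trans (errE _ _ ij js).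
      by have := is_derive_dsub _ _ _ dYs; rewrite col_mxKd.
    - move=> s is'; rewrite (le_trans (enorm_dsub _))// (le_trans (hN s is'))//.
      rewrite -[leRHS]mulr1 ler_wpM2l// -expR0 ler_expR mulNr oppr_le0.
      by rewrite mulr_ge0 ?(ltW a0)// subr_ge0.
  rewrite (le_trans (lerD hu hv))// -mulrDl ler_wpM2r ?expR_ge0//.
  have -> : K * enorm (usubmx (Y tau)) + K * E / (sigma - alpha) +
      K * E / (sigma + alpha) = K * enorm (usubmx (Y tau)) + D * E.
    by rewrite /D; field; rewrite !gt_eqF.
  rewrite /c -addrA lerD2l /E mulrDr [leLHS]addrC lerD2l.
  by rewrite mulrA [D * _]mulrC ler_wpM2r.
(* The supremum of [S] is the smallest admissible decay constant. *)
pose S := [set enorm (Y t) / expR (- alpha * (t - tau)) | t in [set t | tau <= t]].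
have Sub N : (forall t, tau <= t ->
    enorm (Y t) <= N * expR (- alpha * (t - tau))) -> ubound S N.
  by move=> hN _ [t /= it <-]; rewrite ler_pdivrMr ?expR_gt0// hN.
have S0 : S (enorm (Y tau) / expR (- alpha * (tau - tau))).
  by exists tau => /=.
have Snb : has_ubound S by exists N0; exact: Sub.
have supS t : tau <= t -> enorm (Y t) <= sup S * expR (- alpha * (t - tau)).
  move=> it; rewrite -ler_pdivrMr ?expR_gt0//; apply: sup_ubound => //.
  by exists t.
have supS0 : 0 <= sup S.
  by apply: le_trans (sup_ubound Snb S0); rewrite divr_ge0 ?expR_ge0.
have : sup S <= c + 2^-1 * sup S.
  apply: ge_sup; first by exists (enorm (Y tau) / expR (- alpha * (tau - tau))).
  exact/Sub/improve.
move=> h t it; rewrite (le_trans (supS t it))// ler_wpM2r ?expR_ge0// -/c; lra.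
Qed.

(** * Uniform strict differentiability of the nonlinearity *)

Lemma is_diff_mulmx {R : realType} {m n} (A : 'M[R]_(m, n)) (x : 'cV[R]_n) :
  is_diff x (mulmx A : 'cV[R]_n -> 'cV[R]_m) (mulmx A).
Proof.
have cA : continuous (mulmx A : 'cV[R]_n -> 'cV[R]_m).
  move=> y; apply: (continuous_mulmx (fun _ : 'cV[R]_n => A) id).
    exact: cst_continuous.
  exact: cvg_id.
apply: DiffDef; first exact: linear_differentiable.
exact: (diff_lin _ cA).
Qed.

Lemma is_diff_segment {R : realType} {m n} (f : 'cV[R]_n -> 'cV[R]_m)
    (M : 'M[R]_(m, n)) (x h : 'cV[R]_n) (s : R) :
  is_diff (x + s *: h) f (mulmx M) ->
  is_derive s 1 (fun r : R => f (x + r *: h)) (M *m h).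
Proof.
move=> df.
have da : is_diff s (fun r : R => x + r *: h) (fun r : R => r *: h).
  apply: (is_diff_eq (is_diffD (is_diff_cst x s) (is_diff_scalel s h))).
  by rewrite add0r.
have dc : is_diff s (f \o (fun r : R => x + r *: h))
    (mulmx M \o (fun r : R => r *: h)) by exact: is_diff_comp.
have [dfa E] := dc; apply: DeriveDef; first exact/derivable1_diffP.
have : 'D_1 (f \o (fun r : R => x + r *: h)) s = M *m h.
  by rewrite deriveE// E /= scale1r.
exact.
Qed.

(** Mean value inequality along the segment for [f] minus the linear map [A]. Since [A] need not be
    a derivative at an end point, the bound yields strict differentiability. *)
Lemma segment_increment {R : realType} {m n} (f : 'cV[R]_n -> 'cV[R]_m)
    (df : 'cV[R]_n -> 'M[R]_(m, n)) (A : 'M[R]_(m, n)) (x1 x2 : 'cV[R]_n) (om : R) :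
  (forall x, is_diff x f (mulmx (df x))) ->
  (forall s, 0 < s < 1 -> opnorm (df (x2 + s *: (x1 - x2)) - A) <= om) ->
  enorm (f x1 - f x2 - A *m (x1 - x2)) <= om * enorm (x1 - x2).
Proof.
move=> dff dA; set h := x1 - x2.
pose d (s : R) := f (x2 + s *: h) - s *: (A *m h).
have dd (s : R) : is_derive s 1 d (df (x2 + s *: h) *m h - A *m h).
  have := is_deriveB (is_diff_segment f _ x2 h s (dff _))
    (is_diff_segment (mulmx A) A 0 h s _).
  have -> : (fun r : R => f (x2 + r *: h)) - (fun r : R => A *m (0 + r *: h)) = d.
    by apply/funext => r; rewrite /d scalemxAr -[X in A *m X]add0r.
  by apply; exact: is_diff_mulmx.
have := vec_increment d (fun s => om * enorm h * s) 0 1 ler01 _ _ _.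
rewrite /d scale0r addr0 scale0r subr0 scale1r mulr1 mulr0 subr0 scale1r.
rewrite [x2 + h]addrC subrK addrAC; apply.
- by move=> s; exact: is_derive_continuous (dd s).
- by move=> s; apply: cvgM; [exact: cvg_cst|exact: cvg_id].
- move=> s s01; exists (df (x2 + s *: h) *m h - A *m h), (om * enorm h * 1).
  split; [exact: dd|exact: (is_derive_cmul _ _ _ _ (is_derive_id s 1))|].
  by rewrite mulr1 -mulmxBl; apply: opnorm_le; exact: dA.
Qed.

Lemma enorm_segment {R : realType} {n} (x x1 x2 : 'cV[R]_n) (s d : R) :
  0 < s < 1 -> enorm (x1 - x) < d -> enorm (x2 - x) < d ->
  enorm (x2 + s *: (x1 - x2) - x) < d.
Proof.
move=> /andP[s0 s1] h1 h2.
have -> : x2 + s *: (x1 - x2) - x = s *: (x1 - x) + (1 - s) *: (x2 - x).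
  by apply/matrixP => i j; rewrite !mxE; ring.
rewrite (le_lt_trans (enormD _ _))// !enormZ !gtr0_norm ?subr_gt0//; nra.
Qed.

(** Both points of the increment vary near [(x, w)] while the linear map stays the one at [(x, w)],
    and the radius depends neither on time nor on the base point. This form compares difference
    quotients with different base points along whole trajectories. *)
Definition uniform_strict_diff {R : realType} {m n}
    (g : R -> 'cV[R]_n -> 'cV[R]_n -> 'cV[R]_m)
    (gx gw : R -> 'cV[R]_n -> 'cV[R]_n -> 'M[R]_(m, n)) : Prop :=
  forall om : R, 0 < om -> exists2 d : R, 0 < d &
    forall (t : R) (x w x1 x2 w1 w2 : 'cV[R]_n),
      enorm (x1 - x) < d -> enorm (x2 - x) < d ->
      enorm (w1 - w) < d -> enorm (w2 - w) < d ->
      enorm (g t x1 w1 - g t x2 w2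
        - (gx t x w *m (x1 - x2) + gw t x w *m (w1 - w2)))
      <= om * (enorm (x1 - x2) + enorm (w1 - w2)).

(** Changing first [x] and then [w] leaves two segments inside the ball, on which uniform continuity
    bounds the oscillation of the partial Jacobians by [om]. *)
Lemma unif_cont_diff_strict {R : realType} {n}
    (f : R -> 'cV[R]_n -> 'cV[R]_n -> 'cV[R]_n) : unif_cont_diff f ->
  exists fx fw, uniform_strict_diff f fx fw.
Proof.
move=> [fx [fw [df uc]]]; exists fx, fw => om om0.
have [d d0 hd] := uc om om0; exists d => // t x w x1 x2 w1 w2 hx1 hx2 hw1 hw2.
have h1 : enorm (f t x1 w1 - f t x2 w1 - fx t x w *m (x1 - x2))
    <= om * enorm (x1 - x2).
  apply: (segment_increment (fun y => f t y w1) (fun y => fx t y w1)).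
    by move=> y; have [] := df t y w1.
  move=> s s01; have [/ltW//] := hd t (x2 + s *: (x1 - x2)) x w1 w
    (enorm_segment _ _ _ _ _ s01 hx1 hx2) hw1.
have h2 : enorm (f t x2 w1 - f t x2 w2 - fw t x w *m (w1 - w2))
    <= om * enorm (w1 - w2).
  apply: (segment_increment (fun y => f t x2 y) (fun y => fw t x2 y)).
    by move=> y; have [] := df t x2 y.
  move=> s s01; have [_ /ltW//] := hd t x2 x (w2 + s *: (w1 - w2)) w
    hx2 (enorm_segment _ _ _ _ _ s01 hw1 hw2).
rewrite mulrDr (le_trans _ (lerD h1 h2))//.
apply: le_trans (enormD _ _).
rewrite le_eqVlt; apply/orP; left; apply/eqP; congr enorm.
by apply/matrixP => i j; rewrite !mxE; ring.
Qed.

(** The linear changes of variables are bounded uniformly in time, so the radius [d / q1] and the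
    rescaled [om] still do not depend on [t]. *)
Lemma reduced_g_strict {R : realType} {n} (beta : R -> R) (Q : R -> 'M[R]_n)
    (f : R -> 'cV[R]_n -> 'cV[R]_n -> 'cV[R]_n) :
  unif_cont_diff f -> bounded_mx Q -> bounded_mx (fun t => invmx (Q t)) ->
  exists gx gw, uniform_strict_diff (reduced_g beta Q f) gx gw.
Proof.
move=> /unif_cont_diff_strict[fx [fw hf]] [c1 hc1] [c2 hc2].
pose q1 := Num.max 1 c1; pose q2 := Num.max 1 c2.
have q10 : 0 < q1 by rewrite lt_max ltr01.
have q20 : 0 < q2 by rewrite lt_max ltr01.
have Q1 t x : enorm (Q t *m x) <= q1 * enorm x.
  by apply: opnorm_le; rewrite le_max hc1 orbT.
have Q2 t x : enorm (invmx (Q t) *m x) <= q2 * enorm x.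
  by apply: opnorm_le; rewrite le_max hc2 orbT.
exists (fun t x w =>
  invmx (Q t) *m fx t (Q t *m x) (Q (beta t) *m w) *m Q t).
exists (fun t x w =>
  invmx (Q t) *m fw t (Q t *m x) (Q (beta t) *m w) *m Q (beta t)).
move=> om om0; have [|d d0 hd] := hf (om / (q1 * q2)).
  by rewrite divr_gt0// mulr_gt0.
have small t y z : enorm (y - z) < d / q1 -> enorm (Q t *m y - Q t *m z) < d.
  rewrite -mulmxBr ltr_pdivlMr// mulrC; apply: le_lt_trans; exact: Q1.
exists (d / q1); first by rewrite divr_gt0.
move=> t x w x1 x2 w1 w2 hx1 hx2 hw1 hw2.
have := hd t (Q t *m x) (Q (beta t) *m w) (Q t *m x1) (Q t *m x2)
  (Q (beta t) *m w1) (Q (beta t) *m w2) (small _ _ _ hx1) (small _ _ _ hx2)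
  (small _ _ _ hw1) (small _ _ _ hw2).
set e := (X in enorm X <= _) => he.
rewrite [X in enorm X](_ : _ = invmx (Q t) *m e); last first.
  by rewrite /reduced_g /e !(mulmxBr, mulmxDr, mulmxA).
rewrite (le_trans (Q2 _ _))//.
apply: (le_trans (ler_wpM2l (ltW q20) he)).
rewrite -!mulmxBr.
have h1 := Q1 t (x1 - x2); have h2 := Q1 (beta t) (w1 - w2).
have -> : om * (enorm (x1 - x2) + enorm (w1 - w2)) =
  q2 * (om / (q1 * q2) * (q1 * enorm (x1 - x2) + q1 * enorm (w1 - w2))).
  by field; rewrite !gt_eqF.
by rewrite ler_pM2l// ler_pM2l ?divr_gt0 ?mulr_gt0// lerD.
Qed.

(* [S] stands for one of the two projections [usubmx], [dsubmx]. *)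
Lemma strict_diff_lipschitz {R : realType} {m n p}
    (g : R -> 'cV[R]_n -> 'cV[R]_n -> 'cV[R]_m) gx gw
    (S : 'cV[R]_m -> 'cV[R]_p) (L : R) :
  uniform_strict_diff g gx gw ->
  (forall x y, S (x - y) = S x - S y) -> (forall a x, S (a *: x) = a *: S x) ->
  (forall x, enorm (S x) <= enorm x) ->
  (forall t x1 x2 w1 w2, enorm (S (g t x1 w1) - S (g t x2 w2))
    <= L * (enorm (x1 - x2) + enorm (w1 - w2))) ->
  forall t x w a b, enorm (S (gx t x w *m a + gw t x w *m b))
    <= L * (enorm a + enorm b).
Proof.
move=> hg SB SZ S1 lip t x w a b.
have ab : 0 <= enorm a + enorm b by rewrite addr_ge0.
apply/ler_addgt0Pr => e e0.
pose om := e / (1 + (enorm a + enorm b)).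
have ab1 : 0 < 1 + (enorm a + enorm b) by rewrite ltr_wpDr.
have om0 : 0 < om by rewrite divr_gt0.
have [d d0 hd] := hg om om0.
(* Scaling by [s] brings the increments [a] and [b] inside the radius [d]; by linearity the factor
   [s] cancels at the end. *)
pose s := d / (1 + (enorm a + enorm b)).
have s0 : 0 < s by rewrite divr_gt0.
have sE y : enorm y <= enorm a + enorm b -> enorm (s *: y) < d.
  move=> yab; rewrite enormZ gtr0_norm// /s mulrAC ltr_pdivrMr//.
  by rewrite ltr_pM2l// (le_lt_trans yab)// ltrDr.
have E (y z : 'cV[R]_n) : z + y - z = y by rewrite addrC addKr.
have := hd t x w (x + s *: a) x (w + s *: b) w.
have sa : enorm (s *: a) < d by apply: sE; rewrite lerDl.
have sb : enorm (s *: b) < d by apply: sE; rewrite lerDr.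
rewrite !subrr enorm0 !E => /(_ sa d0 sb d0).
set dg := g _ _ _ - g _ _ _; rewrite -!scalemxAr -scalerDr.
set G := gx t x w *m a + gw t x w *m b => h1.
have h2 := lip t (x + s *: a) x (w + s *: b) w.
rewrite !E !enormZ gtr0_norm// -SB -/dg in h2.
have h3 := le_trans (S1 (dg - s *: G)) h1.
rewrite SB SZ !enormZ gtr0_norm// in h3.
have h4 := enormB (S dg) (S dg - s *: S G).
rewrite opprB addrC subrK enormZ gtr0_norm// in h4.
rewrite -(ler_pM2l s0) mulrDr.
have h5 : om * (s * enorm a + s * enorm b) <= s * e.
  have -> : om * (s * enorm a + s * enorm b) = s * (om * (enorm a + enorm b)).
    by ring.
  rewrite ler_pM2l// /om mulrAC ler_pdivrMr// ler_pM2l// lerDr//.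
have -> : s * (L * (enorm a + enorm b)) = L * (s * enorm a + s * enorm b) by ring.
lra.
Qed.

(** * Strict derivatives *)

Definition strict_diff_at {R : realType} {k p : nat} (Z : 'cV[R]_k -> 'cV[R]_p)
    (a : 'cV[R]_k) (M : 'M[R]_(p, k)) : Prop :=
  forall om : R, 0 < om -> exists2 d : R, 0 < d &
    forall a1 a2, enorm (a1 - a) < d -> enorm (a2 - a) < d ->
      enorm (Z a1 - Z a2 - M *m (a1 - a2)) <= om * enorm (a1 - a2).

(** By completeness the quotients based at [a] converge to some [v]. Taking [c = a] in the Cauchy
    condition and letting [y] tend to 0 then compares the quotients at every nearby [b] with [v]. *)
Lemma cauchy_directional {R : realType} {k p : nat} (Z : 'cV[R]_k -> 'cV[R]_p)
    (a h : 'cV[R]_k) : enorm h <= 1 ->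
  (forall om : R, 0 < om -> exists2 d : R, 0 < d &
    forall b c (x y : R), x != 0 -> y != 0 ->
      enorm (b - a) < d -> enorm (b + x *: h - a) < d ->
      enorm (c - a) < d -> enorm (c + y *: h - a) < d ->
      enorm (x^-1 *: (Z (b + x *: h) - Z b) - y^-1 *: (Z (c + y *: h) - Z c))
        <= om) ->
  exists v : 'cV[R]_p, forall om : R, 0 < om -> exists2 d : R, 0 < d &
    forall b (x : R), enorm (b - a) < d -> enorm (b + x *: h - a) < d ->
      enorm (Z (b + x *: h) - Z b - x *: v) <= om * `|x|.
Proof.
move=> h1 H; pose D (x : R) := x^-1 *: (Z (a + x *: h) - Z a).
have small (x d : R) : `|x| < d -> enorm (a + x *: h - a) < d.
  move=> xd; rewrite addrC addKr enormZ (le_lt_trans _ xd)//.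
  by rewrite -[leRHS]mulr1 ler_wpM2l.
have cD : cvg (D @ 0^').
  apply: cauchy_cvg; apply: cauchy_exP => e e0.
  have [|d d0 hd] := H (e / 2); first by rewrite divr_gt0.
  exists (D (d / 2)).
  have d20 : 0 < d / 2 by rewrite divr_gt0.
  have nd : \forall x \near 0^', `|x| < d /\ x != 0 :> R.
    near=> x; split; last by near: x; exact: nbhs_dnbhs_neq.
    by near: x; exact: dnbhs0_lt.
  apply: filterS nd => x [xd x0] /=.
  rewrite -ball_normE /=; apply: le_lt_trans (norm_le_enorm _) _.
  apply: (@le_lt_trans _ _ (e / 2)); last by rewrite ltr_pdivrMr// ltr_pMr// ltr1n.
  apply: hd => //; rewrite ?gt_eqF// ?subrr ?enorm0//; apply: small => //.
  by rewrite gtr0_norm// ltr_pdivrMr// ltr_pMr// ltr1n.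
move/cvg_ex: cD => [v Dv]; exists v => om om0.
have [d d0 hd] := H om om0; exists d => // b x hb hbx.
have [->|x0] := eqVneq x 0.
  by rewrite !scale0r addr0 subr0 subrr enorm0 normr0 mulr0.
suff : enorm (x^-1 *: (Z (b + x *: h) - Z b) - v) <= om.
  move=> le; have -> : Z (b + x *: h) - Z b - x *: v =
      x *: (x^-1 *: (Z (b + x *: h) - Z b) - v).
    by rewrite scalerBr scalerA divff// scale1r.
  by rewrite enormZ mulrC ler_wpM2r.
apply/ler_addgt0Pr => e e0.
(* The denominator absorbs the factor [p] between the maximum and the Euclidean norm; the added 1
   keeps it positive in dimension 0. *)
have pe : 0 < e / (p%:R + 1) by rewrite divr_gt0// ltr_wpDl.
have nv : \forall y \near 0^', [/\ `|y| < d, y != 0 :> R &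
    `|v - D y| <= e / (p%:R + 1)].
  near=> y; split.
  - by near: y; exact: dnbhs0_lt.
  - by near: y; exact: nbhs_dnbhs_neq.
  - by near: y; move/cvgrPdist_le: Dv => /(_ _ pe).
have [y [yd y0 yv]] := filter_ex nv.
have -> : x^-1 *: (Z (b + x *: h) - Z b) - v =
  (x^-1 *: (Z (b + x *: h) - Z b) - D y) + - (v - D y).
  by rewrite opprB addrA subrK.
rewrite (le_trans (enormD _ _))// enormN lerD//.
  by apply: hd => //; rewrite ?subrr ?enorm0//; exact: small.
rewrite (le_trans (enorm_le_norm _))// (le_trans (ler_wpM2l _ yv))//.
rewrite mulrCA -[leRHS]mulr1 ler_wpM2l ?(ltW e0)//.
by rewrite ler_pdivrMr ?mul1r ?lerDl// ltr_wpDl.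
Unshelve. all: by end_near. Qed.

(* Going from [a2] to [a1] one coordinate at a time reduces the increment of
   [Z] to increments along the basis vectors. *)
Lemma cauchy_strict {R : realType} {k p : nat} (Z : 'cV[R]_k -> 'cV[R]_p)
    (a : 'cV[R]_k) :
  (forall om : R, 0 < om -> exists2 d : R, 0 < d &
    forall h b c (x y : R), enorm h <= 1 -> x != 0 -> y != 0 ->
      enorm (b - a) < d -> enorm (b + x *: h - a) < d ->
      enorm (c - a) < d -> enorm (c + y *: h - a) < d ->
      enorm (x^-1 *: (Z (b + x *: h) - Z b) - y^-1 *: (Z (c + y *: h) - Z c))
        <= om) ->
  exists M, strict_diff_at Z a M.
Proof.
move=> H.
have /choice[v hv] : forall j : 'I_k, exists v : 'cV[R]_p, forall om : R, 0 < om ->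
    exists2 d : R, 0 < d &
    forall b (x : R), enorm (b - a) < d ->
      enorm (b + x *: delta_mx j 0 - a) < d ->
      enorm (Z (b + x *: delta_mx j 0) - Z b - x *: v) <= om * `|x|.
  move=> j; apply: cauchy_directional; first by rewrite enorm_delta.
  move=> om om0; have [d d0 hd] := H om om0; exists d => // b c x y.
  by apply: hd; rewrite enorm_delta.
exists (\matrix_(i, j) v j i 0) => om om0.
have om' : 0 < om / (k%:R + 1) by rewrite divr_gt0// ltr_wpDl.
have /choice[dd hdd] : forall j : 'I_k, exists d : R, 0 < d /\
    forall b (x : R), enorm (b - a) < d ->
      enorm (b + x *: delta_mx j 0 - a) < d ->
      enorm (Z (b + x *: delta_mx j 0) - Z b - x *: v j)
        <= om / (k%:R + 1) * `|x|.
  by move=> j; have [d d0 hd] := hv j _ om'; exists d.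
pose d := \big[Num.min/1]_(j < k) dd j.
have d0 : 0 < d.
  by apply: lt_bigmin => // j _; have [] := hdd j.
have dle j : d <= dd j by exact: bigmin_le_cond.
(* The radius is halved because the intermediate points mix coordinates of [a1] and [a2]: their
   distance to [a] is bounded by the sum of both distances. *)
exists (d / 2); first by rewrite divr_gt0.
move=> a1 a2 h1 h2.
pose b m : 'cV[R]_k := \col_j (if (j < m)%N then a1 j 0 else a2 j 0).
have bd m : enorm (b m - a) < d.
  apply: (@le_lt_trans _ _ (enorm (a1 - a) + enorm (a2 - a))); last lra.
  apply: le_of_sqr; first by rewrite addr_ge0.
  apply: (@le_trans _ _ (enorm (a1 - a) ^+ 2 + enorm (a2 - a) ^+ 2)).
    rewrite -!edotxx /edot -big_split /=; apply: ler_sum => j _.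
    rewrite !mxE; case: ifP => _; rewrite -?expr2.
      by rewrite lerDl sqr_ge0.
    by rewrite lerDr sqr_ge0.
  have := enorm_ge0 (a1 - a); have := enorm_ge0 (a2 - a); nra.
have bS (j : 'I_k) : b j.+1 = b j + (a1 - a2) j 0 *: delta_mx j 0.
  apply/matrixP => i l; rewrite ord1 !mxE ltnS eqxx andbT.
  case: (ltngtP i j) => [ij|ij|/val_inj ->].
  - by rewrite (_ : (i == j) = false) ?mulr0 ?addr0// -val_eqE ltn_eqF.
  - by rewrite (_ : (i == j) = false) ?mulr0 ?addr0// -val_eqE gtn_eqF.
  - by rewrite eqxx mulr1 addrC subrK.
have bk : b k = a1.
  by apply/matrixP => i l; rewrite ord1 mxE ltn_ord.
have b0 : b 0%N = a2 by apply/matrixP => i l; rewrite ord1 mxE ltn0.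
have -> : Z a1 - Z a2 - (\matrix_(i, j) v j i 0) *m (a1 - a2) =
    \sum_(j < k) (Z (b j.+1) - Z (b j) - (a1 - a2) j 0 *: v j).
  rewrite [RHS]big_split /= sumrN; congr (_ - _).
    by rewrite -(big_mkord xpredT (fun j => Z (b j.+1) - Z (b j)))
      telescope_sumr// bk b0.
  apply/matrixP => i l; rewrite ord1 summxE mxE; apply: eq_bigr => j _.
  by rewrite !mxE mulrC.
rewrite (le_trans (enorm_sum _ _))//.
apply: (@le_trans _ _ (\sum_(j < k) om / (k%:R + 1) * enorm (a1 - a2))).
  apply: ler_sum => j _; rewrite {1}bS.
  have [_ hj] := hdd j; apply: (le_trans (hj _ _ _ _)).
  - exact: lt_le_trans (dle j).
  - by rewrite -bS; exact: lt_le_trans (dle j).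
  - by rewrite ler_wpM2l ?(ltW om')// coord_le_enorm.
have -> : \sum_(j < k) om / (k%:R + 1) * enorm (a1 - a2) =
    k%:R * (om / (k%:R + 1) * enorm (a1 - a2)).
  by rewrite sumr_const card_ord mulr_natl.
rewrite mulrA ler_wpM2r//.
rewrite mulrCA -[leRHS]mulr1 ler_wpM2l ?(ltW om0)//.
by rewrite ler_pdivrMr ?mul1r ?lerDl// ltr_wpDl.
Qed.

Lemma is_diff_littleo {R : realType} {V W : normedModType R} (f : V -> W)
    (df : {linear V -> W}) (x : V) : continuous df ->
  (forall e : R, 0 < e ->
    \forall y \near (0 : V), `|f (y + x) - (f x + df y)| <= e * `|y|) ->
  is_diff x f df.
Proof.
move=> cdf h.
have e : f \o shift x = cst (f x) + df +o_ 0 id by exact/eqaddoP.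
have E := diff_unique cdf e.
by apply: DiffDef => //; apply/diff_locallyP; rewrite E.
Qed.

Lemma strict_diff_is_diff {R : realType} {k p : nat}
    (Z : 'cV[R]_k -> 'cV[R]_p) (a : 'cV[R]_k) (M : 'M[R]_(p, k)) :
  strict_diff_at Z a M -> is_diff a Z (mulmx M).
Proof.
move=> H.
have cM : continuous (mulmx M : 'cV[R]_k -> 'cV[R]_p).
  move=> y; apply: differentiable_continuous.
  by have [] := is_diff_mulmx M y.
apply: is_diff_littleo => // e e0.
have k0 : 0 < k%:R + 1 :> R by rewrite ltr_wpDl.
have [|d d0 hd] := H (e / (k%:R + 1)); first by rewrite divr_gt0.
have kx (x : 'cV[R]_k) : enorm x <= (k%:R + 1) * `|x|.
  by rewrite (le_trans (enorm_le_norm _))// ler_wpM2r// lerDl.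
near=> x.
have xd : enorm x < d.
  rewrite (le_lt_trans (kx x))// mulrC -ltr_pdivlMr//.
  rewrite -normrN -[- x]add0r; near: x.
  have : (fun u : 'cV[R]_k => u) @ (0 : 'cV[R]_k) --> (0 : 'cV[R]_k).
    exact: cvg_id.
  by move=> /cvgrPdist_lt; apply; rewrite divr_gt0.
have := hd (x + a) a; rewrite subrr enorm0 addrK => /(_ xd d0) h.
rewrite opprD addrA (le_trans (norm_le_enorm _))// (le_trans h)//.
by rewrite mulrAC ler_pdivrMr// -mulrA [`|_| * _]mulrC ler_wpM2l// ltW.
Unshelve. all: by end_near. Qed.

Lemma continuous_mx_near {R : realType} {T : topologicalType} {m n}
    (M : T -> 'M[R]_(m, n)) t :
  (forall i j (e : R), 0 < e -> \forall u \near t, `|M t i j - M u i j| <= e) ->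
  {for t, continuous M}.
Proof.
by move=> h; apply/continuous_mxP => i j; apply/cvgrPdist_le => e; exact: h.
Qed.

(** For [u] near [a], both [J u] and [J a] approximate the same increment [Z (u + y) - Z u] with [y]
    a small multiple of a basis vector, so corresponding columns differ by at most [e]. *)
Lemma strict_cont_diff {R : realType} {k p : nat} (Z : 'cV[R]_k -> 'cV[R]_p) :
  (forall a, exists M, strict_diff_at Z a M) -> cont_diff Z.
Proof.
move=> /choice[J HJ]; exists J => [a|a]; first exact: strict_diff_is_diff.
apply: continuous_mx_near => i j e e0.
have [|d d0 hd] := HJ a (e / 2); first by rewrite divr_gt0.
have k0 : 0 < k%:R + 1 :> R by rewrite ltr_wpDl.
near=> u.
have ud : enorm (u - a) < d.
  apply: (@le_lt_trans _ _ ((k%:R + 1) * `|u - a|)).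
    by rewrite (le_trans (enorm_le_norm _))// ler_wpM2r// lerDl.
  rewrite mulrC -ltr_pdivlMr// distrC.
  near: u; have : (fun u : 'cV[R]_k => u) @ a --> a by exact: cvg_id.
  by move=> /cvgrPdist_lt; apply; rewrite divr_gt0.
have [|du du0 hu] := HJ u (e / 2); first by rewrite divr_gt0.
(* Small enough for [u + y] to lie both in the ball around [u] and in the one around [a]. *)
pose s := Num.min du (d - enorm (u - a)) / 2.
have s0 : 0 < s by rewrite divr_gt0// lt_min du0 subr_gt0.
have : s < Num.min du (d - enorm (u - a)).
  by rewrite ltr_pdivrMr// ltr_pMr ?ltr1n// lt_min du0 subr_gt0.
rewrite lt_min => /andP[s1 s2].
pose y : 'cV[R]_k := s *: delta_mx j 0.
have yE : enorm y = s by rewrite enormZ enorm_delta mulr1 gtr0_norm.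
have E : u + y - u = y by rewrite addrC addKr.
have := hd (u + y) u; have := hu (u + y) u; rewrite subrr enorm0 !E yE.
move=> /(_ s1 du0) k1 /(_ _ ud) k2.
have {}k2 : enorm (Z (u + y) - Z u - J a *m y) <= e / 2 * s.
  by apply: k2; rewrite addrAC (le_lt_trans (enormD _ _))// yE; lra.
have : enorm ((J a - J u) *m y) <= e * s.
  rewrite mulmxBl; have -> : J a *m y - J u *m y =
    (Z (u + y) - Z u - J u *m y) - (Z (u + y) - Z u - J a *m y).
    by rewrite opprB [RHS]addrC addrA subrK.
  by rewrite (le_trans (enormB _ _))//; lra.
rewrite -scalemxAr enormZ gtr0_norm// mulrC ler_pM2r// => h.
apply: le_trans h; have := coord_le_enorm ((J a - J u) *m delta_mx j 0) i.
by rewrite -colE !mxE.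
Unshelve. all: by end_near. Qed.

(** * Differentiability of decaying solutions in the initial value *)

Lemma linear_block {R : realType} {n p} (M : 'M[R]_p)
    (S : {linear 'cV[R]_n -> 'cV[R]_p}) (x y : R) (a b e f : 'cV[R]_n) :
  x *: (M *m S a + S e) - y *: (M *m S b + S f) =
  M *m S (x *: a - y *: b) + S (x *: e - y *: f).
Proof.
rewrite ![S (_ - _)]linearB ![S (_ *: _)]linearZ /= mulmxBr.
by rewrite -!scalemxAr !scalerDr opprD addrACA.
Qed.

Section manifold.
Context {R : realType} {k q : nat} (th : R) (theta : int -> R) (beta : R -> R)
  (Bp : R -> 'M[R]_k) (Bm : R -> 'M[R]_q)
  (U : R -> R -> 'M[R]_k) (V : R -> R -> 'M[R]_q) (C K sigma alpha L : R)
  (g : R -> 'cV[R]_(k + q) -> 'cV[R]_(k + q) -> 'cV[R]_(k + q))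
  (gx gw : R -> 'cV[R]_(k + q) -> 'cV[R]_(k + q) -> 'M[R]_(k + q)).
Let D := K * ((sigma - alpha)^-1 + (sigma + alpha)^-1).
Hypotheses (sw : switching_times th theta) (be : is_beta theta beta)
  (C0 : 0 <= C)
  (BpC : forall t x, enorm (Bp t *m x) <= C * enorm x)
  (BmC : forall t x, enorm (Bm t *m x) <= C * enorm x)
  (tU : transition_matrix Bp U) (tV : transition_matrix Bm V)
  (K0 : 0 < K) (as0 : 0 < alpha < sigma)
  (UK : forall t s x, s <= t ->
    enorm (U t s *m x) <= K * expR (- sigma * (t - s)) * enorm x)
  (VK : forall t s x, t <= s ->
    enorm (V t s *m x) <= K * expR (- sigma * (s - t)) * enorm x)
  (L0 : 0 <= L) (LD : L * (1 + expR (alpha * th)) * D <= 2^-1)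
  (gL : forall (t : R) (z1 z2 w1 w2 : 'cV[R]_(k + q)),
     enorm (usubmx (g t z1 w1) - usubmx (g t z2 w2))
     + enorm (dsubmx (g t z1 w1) - dsubmx (g t z2 w2))
       <= L * (enorm (z1 - z2) + enorm (w1 - w2)))
  (gd : uniform_strict_diff g gx gw).
Let rhs := reduced_rhs Bp Bm (fun t z w => usubmx (g t z w))
  (fun t z w => dsubmx (g t z w)).
Context (i : int).
Let tau := theta i.

Let decays (z : R -> 'cV[R]_(k + q)) := exists N : R, forall t, tau <= t ->
  enorm (z t) <= N * expR (- alpha * (t - tau)).

Lemma decaysB z1 z2 (x y : R) : decays z1 -> decays z2 ->
  decays (fun t => x *: z1 t - y *: z2 t).
Proof.
move=> [N1 h1] [N2 h2]; exists (`|x| * N1 + `|y| * N2) => t it.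
rewrite (le_trans (enormB _ _))// !enormZ mulrDl -!mulrA.
by rewrite lerD// ler_wpM2l// ?h1// h2.
Qed.

Lemma gLu t z1 z2 w1 w2 : enorm (usubmx (g t z1 w1) - usubmx (g t z2 w2))
  <= L * (enorm (z1 - z2) + enorm (w1 - w2)).
Proof.
by apply: le_trans (gL t z1 z2 w1 w2); rewrite lerDl.
Qed.

Lemma gLd t z1 z2 w1 w2 : enorm (dsubmx (g t z1 w1) - dsubmx (g t z2 w2))
  <= L * (enorm (z1 - z2) + enorm (w1 - w2)).
Proof.
by apply: le_trans (gL t z1 z2 w1 w2); rewrite lerDr.
Qed.

Lemma solution_diff_derive z1 z2 (j : int) (s : R) :
  solution theta beta rhs z1 -> solution theta beta rhs z2 ->
  theta j < s < theta (j + 1) ->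
  let e := g s (z1 s) (z1 (beta s)) - g s (z2 s) (z2 (beta s)) in
  is_derive s 1 (fun r => z1 r - z2 r)
    (col_mx (Bp s *m usubmx (z1 s - z2 s) + usubmx e)
      (Bm s *m dsubmx (z1 s - z2 s) + dsubmx e)).
Proof.
move=> [_ /(_ j)[s1 _]] [_ /(_ j)[s2 _]] js /=.
have := is_deriveB (s1 s js) (s2 s js).
rewrite /rhs /reduced_rhs opp_col_mx add_col_mx.
by rewrite !linearB /= opprD addrACA opprD [X in col_mx _ X]addrACA.
Qed.

(** The case [eta = 0] of [key_estimate]. It gives Lipschitz dependence on the first block at [tau]
    and, when these blocks agree, uniqueness of decaying solutions on [[tau, +oo)]. *)
Lemma solution_diff z1 z2 :
  solution theta beta rhs z1 -> solution theta beta rhs z2 ->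
  decays z1 -> decays z2 ->
  forall t, tau <= t -> enorm (z1 t - z2 t) <=
    2 * K * enorm (usubmx (z1 tau) - usubmx (z2 tau))
      * expR (- alpha * (t - tau)).
Proof.
move=> s1 s2 d1 d2 t it; have [N hN] := decaysB _ _ 1 1 d1 d2.
have -> : 2 * K * enorm (usubmx (z1 tau) - usubmx (z2 tau)) =
    2 * (K * enorm (usubmx (z1 tau - z2 tau)) + D * 0).
  by rewrite mulr0 addr0 mulrA linearB.
apply: (key_estimate th theta beta i Bp Bm U V C K sigma alpha L 0 N
  (fun t => z1 t - z2 t)) => //.
- by move=> s; apply: cvgB; [have [cs _] := s1|have [cs _] := s2]; exact: cs.
- move=> j s ij js.
  exists (usubmx (g s (z1 s) (z1 (beta s)) - g s (z2 s) (z2 (beta s)))).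
  exists (dsubmx (g s (z1 s) (z1 (beta s)) - g s (z2 s) (z2 (beta s)))).
  split; first exact: (solution_diff_derive z1 z2 j).
    by rewrite mul0r addr0 linearB; exact: gLu.
  by rewrite mul0r addr0 linearB; exact: gLd.
- by move=> s is'; have := hN s is'; rewrite !scale1r.
Qed.

(** The difference [Y] of the two quotients solves the equation linearised along [zs] up to an error
    proportional to [om], and its first block vanishes at [tau]; [key_estimate] then leaves only the
    error term. *)
Lemma solution_quotient z1 z2 z3 z4 zs (x y om d W : R) :
  solution theta beta rhs z1 -> solution theta beta rhs z2 ->
  solution theta beta rhs z3 -> solution theta beta rhs z4 ->
  decays z1 -> decays z2 -> decays z3 -> decays z4 ->
  x != 0 -> y != 0 -> 0 <= om -> 0 <= W ->
  (forall (t : R) (x w x1 x2 w1 w2 : 'cV[R]_(k + q)),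
      enorm (x1 - x) < d -> enorm (x2 - x) < d ->
      enorm (w1 - w) < d -> enorm (w2 - w) < d ->
      enorm (g t x1 w1 - g t x2 w2
        - (gx t x w *m (x1 - x2) + gw t x w *m (w1 - w2)))
      <= om * (enorm (x1 - x2) + enorm (w1 - w2))) ->
  (forall t, tau <= t -> [/\ enorm (z1 t - zs t) < d, enorm (z2 t - zs t) < d,
     enorm (z3 t - zs t) < d & enorm (z4 t - zs t) < d]) ->
  (forall t, tau <= t ->
    enorm (x^-1 *: (z1 t - z2 t)) <= W * expR (- alpha * (t - tau)) /\
    enorm (y^-1 *: (z3 t - z4 t)) <= W * expR (- alpha * (t - tau))) ->
  usubmx (x^-1 *: (z1 tau - z2 tau) - y^-1 *: (z3 tau - z4 tau)) = 0 ->
  forall t, tau <= t ->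
    enorm (x^-1 *: (z1 t - z2 t) - y^-1 *: (z3 t - z4 t))
      <= 4 * D * W * (1 + expR (alpha * th)) * om.
Proof.
move=> s1 s2 s3 s4 d1 d2 d3 d4 x0 y0 om0 W0 hg close bW Yu t it.
have [a0 a_s] := andP as0.
have D0 : 0 < D.
  by rewrite mulr_gt0// addr_gt0// invr_gt0; lra.
(* Each of the two quotients contributes one linearisation error; [1] and [exp(alpha th)] stem from
   the current and the retarded argument. *)
pose eta := 2 * om * (W * (1 + expR (alpha * th))).
have eta0 : 0 <= eta by rewrite !mulr_ge0// addr_ge0// expR_ge0.
pose Y t := x^-1 *: (z1 t - z2 t) - y^-1 *: (z3 t - z4 t).
have [N1 hN1] := decaysB _ _ 1 1 d1 d2.
have [N2 hN2] := decaysB _ _ 1 1 d3 d4.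
have [N hN] : decays Y.
  have [||N hN] := decaysB (fun t => 1 *: z1 t - 1 *: z2 t)
    (fun t => 1 *: z3 t - 1 *: z4 t) x^-1 y^-1; [by exists N1|by exists N2|].
  by exists N => r ir; have := hN r ir; rewrite !scale1r.
have quot (u v z w : 'cV[R]_(k + q)) (p : R) (E : 'cV[R]_(k + q)) r s xs ws :
    p != 0 -> enorm (E - (gx r xs ws *m (u - v) + gw r xs ws *m (z - w)))
      <= om * (enorm (u - v) + enorm (z - w)) ->
    enorm (p^-1 *: (u - v)) <= W * expR (- alpha * (s - tau)) ->
    enorm (p^-1 *: (z - w)) <= W * (expR (alpha * th) * expR (- alpha * (s - tau)))
    -> enorm (p^-1 *: E - (gx r xs ws *m (p^-1 *: (u - v))
         + gw r xs ws *m (p^-1 *: (z - w))))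
       <= om * (W * (1 + expR (alpha * th)) * expR (- alpha * (s - tau))).
  move=> p0 h1 h2 h3.
  rewrite -!scalemxAr -scalerDr -scalerBr enormZ.
  apply: (@le_trans _ _ (`|p^-1| * (om * (enorm (u - v) + enorm (z - w))))).
    by rewrite ler_wpM2l.
  rewrite mulrCA ler_wpM2l// mulrDr -!enormZ.
  rewrite mulrDr mulr1 mulrDl -mulrA; lra.
have main (s : R) (j : int) : i <= j -> theta j < s < theta (j + 1) ->
    exists2 e : 'cV[R]_(k + q), is_derive s 1 Y
      (col_mx (Bp s *m usubmx (Y s) + usubmx e)
        (Bm s *m dsubmx (Y s) + dsubmx e)) &
    enorm (e - (gx s (zs s) (zs (beta s)) *m Y s
         + gw s (zs s) (zs (beta s)) *m Y (beta s)))
      <= eta * expR (- alpha * (s - tau)).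
  move=> ij js.
  pose e1 := g s (z1 s) (z1 (beta s)) - g s (z2 s) (z2 (beta s)).
  pose e3 := g s (z3 s) (z3 (beta s)) - g s (z4 s) (z4 (beta s)).
  exists (x^-1 *: e1 - y^-1 *: e3).
    have h := is_deriveB
      (is_deriveZ x^-1 (solution_diff_derive z1 z2 j s s1 s2 js))
      (is_deriveZ y^-1 (solution_diff_derive z3 z4 j s s3 s4 js)).
    apply: (is_derive_eq h).
    rewrite /Y !scale_col_mx opp_col_mx add_col_mx -/e1 -/e3.
    congr col_mx; last exact: (linear_block _ dsubmx).
    exact: (linear_block _ usubmx).
  have js' : theta j <= s < theta (j + 1) by case/andP: js => /ltW -> ->.
  have [/andP[b1 b2] b3] := beta_bounds _ _ _ sw be i j s ij js'.
  have is' : tau <= s := le_trans b1 b2.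
  have [c1 c2 c3 c4] := close s is'; have [c5 c6 c7 c8] := close _ b1.
  have [w1 w2] := bW s is'; have [w3 w4] := bW _ b1.
  have h3 : W * expR (- alpha * (beta s - tau)) <=
      W * (expR (alpha * th) * expR (- alpha * (s - tau))).
    rewrite ler_wpM2l// -expRD ler_expR -subr_ge0.
    rewrite (_ : _ - _ = alpha * (beta s + th - s)); last by ring.
    by rewrite mulr_ge0 ?(ltW a0)// subr_ge0.
  have q1 := quot _ _ _ _ _ _ _ _ _ _ x0
    (hg s (zs s) (zs (beta s)) _ _ _ _ c1 c2 c5 c6) w1 (le_trans w3 h3).
  have q2 := quot _ _ _ _ _ _ _ _ _ _ y0
    (hg s (zs s) (zs (beta s)) _ _ _ _ c3 c4 c7 c8) w2 (le_trans w4 h3).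
  have -> : eta * expR (- alpha * (s - tau)) =
      om * (W * (1 + expR (alpha * th)) * expR (- alpha * (s - tau))) +
      om * (W * (1 + expR (alpha * th)) * expR (- alpha * (s - tau))).
    by rewrite /eta; ring.
  apply: le_trans (lerD q1 q2); apply: le_trans (enormB _ _).
  rewrite le_eqVlt; apply/orP; left; apply/eqP; congr enorm.
  rewrite /Y !mulmxBr -/e1 -/e3.
  by apply/matrixP => r l; rewrite !mxE; ring.
(* The linearised nonlinearity inherits the constant [L], so [Y] satisfies the differential
   inequality required by [key_estimate]. *)
have GL := strict_diff_lipschitz g gx gw.
apply: (@le_trans _ _ (2 * (K * enorm (usubmx (Y tau)) + D * eta)
      * expR (- alpha * (t - tau)))); last first.
  rewrite /Y Yu enorm0 mulr0 add0r.
  have -> : 4 * D * W * (1 + expR (alpha * th)) * om = 2 * (D * eta).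
    by rewrite /eta; ring.
  rewrite -[leRHS]mulr1 ler_wpM2l//.
    by rewrite mulr_ge0// mulr_ge0// ltW.
  by rewrite -expR0 ler_expR mulNr oppr_le0 mulr_ge0 ?(ltW a0)// subr_ge0.
apply: (key_estimate th theta beta i Bp Bm U V C K sigma alpha L eta N Y) => //.
  have c (z : R -> 'cV[R]_(k + q)) : solution theta beta rhs z -> continuous z.
    by case.
  move=> s; apply: cvgB; apply: cvgZl_tmp.
    by apply: cvgB; exact: c.
  by apply: cvgB; exact: c.
move=> j s ij js; have [e dY he] := main s j ij js.
exists (usubmx e), (dsubmx e); split=> //.
  have lip := GL _ usubmx L gd (fun x y => linearB _ x y) (fun a x => linearZ _ _)
    enorm_usub gLu s (zs s) (zs (beta s)) (Y s) (Y (beta s)).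
  have := le_trans (enorm_usub _) he; rewrite linearB /=.
  set G := usubmx (_ + _) in lip *; have := enormD (usubmx e - G) G.
  rewrite subrK; lra.
have lip := GL _ dsubmx L gd (fun x y => linearB _ x y) (fun a x => linearZ _ _)
  enorm_dsub gLd s (zs s) (zs (beta s)) (Y s) (Y (beta s)).
have := le_trans (enorm_dsub _) he; rewrite linearB /=.
set G := dsubmx (_ + _) in lip *; have := enormD (dsubmx e - G) G.
rewrite subrK; lra.
Qed.

(** At [tau] the first block of every difference quotient in direction [h] is [h] itself, whatever
    the base point and the step. Differences of quotients thus fall under [solution_quotient], and
    [cauchy_strict] applies. *)
Lemma family_strict (zf : 'cV[R]_k -> R -> 'cV[R]_(k + q)) :
  (forall a, [/\ solution theta beta rhs (zf a), usubmx (zf a tau) = a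
    & decays (zf a)]) ->
  forall t, tau <= t -> forall a, exists M, strict_diff_at (fun b => zf b t) a M.
Proof.
move=> hz t it a; have [a0 a_s] := andP as0.
have D0 : 0 < D.
  by rewrite mulr_gt0// addr_gt0// invr_gt0; lra.
have lip b c s : tau <= s -> enorm (zf b s - zf c s) <=
    2 * K * enorm (b - c) * expR (- alpha * (s - tau)).
  move=> is'; have [sb ub db] := hz b; have [sc uc dc] := hz c.
  by have := solution_diff _ _ sb sc db dc s is'; rewrite ub uc.
have e1 s : tau <= s -> expR (- alpha * (s - tau)) <= 1.
  by move=> is'; rewrite -expR0 ler_expR mulNr oppr_le0 mulr_ge0 ?(ltW a0)// subr_ge0.
have K20 : 0 < 2 * K by rewrite mulr_gt0.
apply: cauchy_strict => om om0.
(* The constant of [solution_quotient] for [W = 2 * K], the Lipschitz constant from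
   [solution_diff]. *)
pose c := 4 * D * (2 * K) * (1 + expR (alpha * th)).
have c0 : 0 < c by rewrite mulr_gt0 ?addr_gt0 ?expR_gt0// mulr_gt0// mulr_gt0.
have [|d d0 hd] := gd (om / c); first by rewrite divr_gt0.
exists (d / (2 * K)); first by rewrite divr_gt0.
move=> h b b' x y h1 x0 y0 hb hbx hb' hby.
have close p s : enorm (p - a) < d / (2 * K) -> tau <= s ->
    enorm (zf p s - zf a s) < d.
  move=> pa is'; apply: le_lt_trans (lip _ _ _ is') _.
  apply: (@le_lt_trans _ _ (2 * K * enorm (p - a))).
    by rewrite -[leRHS]mulr1 ler_wpM2l ?e1// mulr_ge0// ltW.
  by rewrite mulrC -ltr_pdivlMr.
have W p r s : r != 0 -> tau <= s ->
    enorm (r^-1 *: (zf (p + r *: h) s - zf p s))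
      <= 2 * K * expR (- alpha * (s - tau)).
  move=> r0 is'; rewrite enormZ normfV ler_pdivrMl ?normr_gt0//.
  apply: (le_trans (lip _ _ _ is')).
  rewrite [p + _]addrC addrK enormZ.
  have -> : 2 * K * (`|r| * enorm h) * expR (- alpha * (s - tau)) =
      `|r| * (2 * K * expR (- alpha * (s - tau))) * enorm h by ring.
  by rewrite -[leRHS]mulr1 ler_wpM2l// !mulr_ge0 ?expR_ge0// ltW.
have [s1 u1 d1] := hz (b + x *: h); have [s2 u2 d2] := hz b.
have [s3 u3 d3] := hz (b' + y *: h); have [s4 u4 d4] := hz b'.
rewrite (_ : om = c * (om / c)); last by rewrite mulrCA divff ?mulr1// gt_eqF.
apply: (solution_quotient _ _ _ _ (zf a) x y (om / c) d (2 * K)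
  s1 s2 s3 s4 d1 d2 d3 d4 x0 y0 _ (ltW K20) hd) => //.
- by rewrite divr_ge0 ?ltW.
- by move=> s is'; split; exact: close.
- by move=> s is'; split; exact: W.
- have -> : usubmx (x^-1 *: (zf (b + x *: h) tau - zf b tau)
      - y^-1 *: (zf (b' + y *: h) tau - zf b' tau)) =
    x^-1 *: (usubmx (zf (b + x *: h) tau) - usubmx (zf b tau))
      - y^-1 *: (usubmx (zf (b' + y *: h) tau) - usubmx (zf b' tau)).
    by apply/matrixP => r l; rewrite !mxE.
  rewrite u1 u2 u3 u4 [b + _]addrC addrK [b' + _]addrC addrK.
  by rewrite !scalerA !mulVf// subrr.
Qed.

End manifold.

(* [al] inverts the first block of [Z] from the right only; the range of [al]
   need not be open, but since the images of its difference quotients under the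
   derivative of that block exhaust the space, the derivative is invertible. *)
Lemma graph_strict {R : realType} {k q : nat} (Z : 'cV[R]_k -> 'cV[R]_(k + q))
    (al : 'cV[R]_k -> 'cV[R]_k) (h : 'cV[R]_k -> 'cV[R]_q) (c : R) :
  (forall a, exists M, strict_diff_at Z a M) ->
  (forall u, Z (al u) = col_mx u (h u)) -> 0 <= c ->
  (forall u1 u2, enorm (al u1 - al u2) <= c * enorm (u1 - u2)) ->
  forall u, exists J, strict_diff_at h u J.
Proof.
move=> SZ Zal c0 lip u; have [M HM] := SZ (al u).
pose Mu : 'M[R]_k := usubmx M; pose Md : 'M[R]_(q, k) := dsubmx M.
have c1 : 0 < c + 1 by rewrite ltr_wpDl.
have near_u d : 0 < d -> forall v, enorm (v - u) < d / (c + 1) ->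
    enorm (al v - al u) < d.
  move=> d0 v; rewrite ltr_pdivlMr// => vd.
  apply: le_lt_trans (lip _ _) _; apply: le_lt_trans vd.
  by rewrite mulrC ler_wpM2l// lerDl.
have Ue u1 u2 : usubmx (Z (al u1) - Z (al u2) - M *m (al u1 - al u2)) =
    (u1 - u2) - Mu *m (al u1 - al u2).
  by rewrite 2!linearB /= !Zal !col_mxKu mul_usub_mx.
have De u1 u2 : dsubmx (Z (al u1) - Z (al u2) - M *m (al u1 - al u2)) =
    (h u1 - h u2) - Md *m (al u1 - al u2).
  by rewrite 2!linearB /= !Zal !col_mxKd mul_dsub_mx.
(* Let [w] be a nonzero left null vector of [Mu]. Moving [u] by [s *: w] makes [s *: w] equal to
   [Mu] times the increment of [al] up to an error of half its length. Pairing with [w] annihilates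
   the image of [Mu], so [enorm w ^+ 2] is at most half of itself. *)
have unitMu : Mu \in unitmx.
  rewrite unitmxE unitfE; apply/negP => /det0P[v v0 vM].
  pose w : 'cV[R]_k := v^T.
  have wM x : edot w (Mu *m x) = 0.
    have : (v *m (Mu *m x)) 0 0 = 0 by rewrite mulmxA vM mul0mx mxE.
    by rewrite mxE => <-; apply: eq_bigr => i _; rewrite !mxE.
  have [|d d0 hd] := HM (2^-1 / (c + 1)); first by rewrite divr_gt0.
  pose s := d / (c + 1) / (2 * (enorm w + 1)).
  have w1 : 0 < enorm w + 1 by rewrite ltr_wpDl.
  have s0 : 0 < s by rewrite divr_gt0 ?divr_gt0// mulr_gt0.
  have E : u + s *: w - u = s *: w by rewrite addrC addKr.
  have sw : enorm (s *: w) < d / (c + 1).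
    rewrite enormZ gtr0_norm// /s mulrAC ltr_pdivrMr ?mulr_gt0//.
    rewrite ltr_pM2l ?divr_gt0//; have := enorm_ge0 w; lra.
  have h1 := hd (al (u + s *: w)) (al u).
  have {}h1 := le_trans (enorm_usub _) (h1 (near_u d d0 (u + s *: w) _) _).
  rewrite Ue E subrr enorm0 in h1; have {h1} := h1 sw d0.
  set x := s *: w - _ => h1.
  have h2 := lip (u + s *: w) u; rewrite E in h2.
  have h3 : enorm x <= 2^-1 * (s * enorm w).
    apply: (le_trans h1); rewrite -mulrA ler_wpM2l// ler_pdivrMl//.
    apply: (le_trans h2); rewrite enormZ gtr0_norm// ler_wpM2r ?lerDl//.
    by rewrite mulr_ge0// ltW.
  have := edot_le w x; rewrite {1}/x edotBr wM subr0 edotZr edotxx => h4.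
  have h5 : s * enorm w ^+ 2 <= 2^-1 * (s * enorm w ^+ 2).
    apply: (le_trans h4); apply: (le_trans (ler_wpM2l (enorm_ge0 w) h3)).
    by rewrite le_eqVlt; apply/orP; left; apply/eqP; ring.
  have h6 : enorm w ^+ 2 <= 0 by rewrite -(ler_pM2l s0) mulr0; lra.
  have /enorm_le0 w00 : enorm w <= 0.
    by apply: le_of_sqr => //; rewrite expr0n.
  by case/eqP: v0; rewrite -[v]trmxK -/w w00 trmx0.
pose J := Md *m invmx Mu; exists J => om om0.
have J1 : 0 < 1 + opnorm J by rewrite ltr_wpDr.
pose om' := om / ((1 + opnorm J) * (c + 1)).
have om'0 : 0 < om' by rewrite divr_gt0// mulr_gt0.
have [d d0 hd] := HM om' om'0; exists (d / (c + 1)); first by rewrite divr_gt0.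
move=> u1 u2 h1 h2.
have := hd _ _ (near_u d d0 _ h1) (near_u d d0 _ h2).
set r := (X in enorm X) => hr.
(* Eliminating the increment of [al] between the two blocks by [invmx Mu] leaves only the remainder
   [r]. *)
have -> : h u1 - h u2 - J *m (u1 - u2) = dsubmx r - J *m usubmx r.
  rewrite /r Ue De [J *m (_ - _ *m _)]mulmxBr mulmxA /J mulmxKV//.
  by rewrite opprB addrA subrK.
rewrite (le_trans (enormB _ _))//.
apply: (@le_trans _ _ ((1 + opnorm J) * enorm r)).
  rewrite mulrDl mul1r lerD ?enorm_dsub//.
  by rewrite (le_trans (opnormP _ _))// ler_wpM2l// enorm_usub.
apply: (@le_trans _ _ ((1 + opnorm J) * (om' * ((c + 1) * enorm (u1 - u2))))).
  rewrite ler_wpM2l ?(ltW J1)// (le_trans hr)// ler_wpM2l ?(ltW om'0)//.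
  by rewrite (le_trans (lip _ _))// ler_wpM2r// lerDl.
rewrite le_eqVlt; apply/orP; left; apply/eqP; rewrite /om'; field.
by rewrite !gt_eqF.
Qed.

(** * The backward estimate and the theorem *)

(** Each block is recovered by applying the bounded block matrix to vectors whose other component is
    zero. The bound [C] serves the regularity of the transition matrices and does not enter the
    decay constants. *)
Lemma generator_bounded {R : realType} {k q : nat} (A Q : R -> 'M[R]_(k + q))
    (Bp : R -> 'M[R]_k) (Bm : R -> 'M[R]_q) :
  bounded_mx A -> bounded_mx Q -> bounded_mx (derive1 Q) ->
  bounded_mx (fun t => invmx (Q t)) ->
  (forall t : R, block_mx (Bp t) 0 0 (Bm t)
     = invmx (Q t) *m A t *m Q t - invmx (Q t) *m (derive1 Q t)) ->
  exists C : R, [/\ 0 <= C,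
    forall t x, enorm (Bp t *m x) <= C * enorm x &
    forall t x, enorm (Bm t *m x) <= C * enorm x].
Proof.
move=> [c1 A1] [c2 Q2] [c3 Q3] [c4 Q4] blk.
have [c10 c20 c30 c40] : [/\ 0 <= c1, 0 <= c2, 0 <= c3 & 0 <= c4].
  by split; [move: (A1 0)|move: (Q2 0)|move: (Q3 0)|move: (Q4 0)];
    exact: le_trans.
exists (c4 * c1 * c2 + c4 * c3).
have bz t z : enorm (block_mx (Bp t) 0 0 (Bm t) *m z) <=
    (c4 * c1 * c2 + c4 * c3) * enorm z.
  rewrite blk mulmxBl (le_trans (enormB _ _))// mulrDl -!mulmxA -!mulrA.
  rewrite lerD// (le_trans (opnorm_le _ _ _ (Q4 t)))// ler_wpM2l//.
    rewrite (le_trans (opnorm_le _ _ _ (A1 t)))// ler_wpM2l//.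
    exact: opnorm_le.
  exact: opnorm_le.
have Ep t x : Bp t *m x = usubmx (block_mx (Bp t) 0 0 (Bm t) *m col_mx x 0).
  by rewrite mul_block_col !mulmx0 mul0mx !addr0 col_mxKu.
have Em t x : Bm t *m x = dsubmx (block_mx (Bp t) 0 0 (Bm t) *m col_mx 0 x).
  by rewrite mul_block_col !mulmx0 mul0mx !add0r col_mxKd.
have C0 : 0 <= c4 * c1 * c2 + c4 * c3 by rewrite addr_ge0 ?mulr_ge0.
split=> // t x.
  rewrite Ep (le_trans (enorm_usub _))// (le_trans (bz _ _))// ler_wpM2l//.
  by rewrite (le_trans (enorm_le_split _))// col_mxKu col_mxKd enorm0 addr0.
rewrite Em (le_trans (enorm_dsub _))// (le_trans (bz _ _))// ler_wpM2l//.
by rewrite (le_trans (enorm_le_split _))// col_mxKu col_mxKd enorm0 add0r.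
Qed.

(* Undoing [y = Q z] gives two solutions of the original system, and the
   condition on [l] bounds their difference at [theta i] by the one at [t0]. *)
Lemma backward_lipschitz {R : realType} {k q : nat} (th : R) (theta : int -> R)
    (beta : R -> R) (A Q : R -> 'M[R]_(k + q))
    (f : R -> 'cV[R]_(k + q) -> 'cV[R]_(k + q) -> 'cV[R]_(k + q))
    (Bp : R -> 'M[R]_k) (Bm : R -> 'M[R]_q) (mu l : R) (i : int) (t0 : R) :
  switching_times th theta -> is_beta theta beta -> 0 < th ->
  0 <= mu -> (forall t, opnorm (A t) <= mu) -> 0 <= l ->
  (forall (t : R) (y1 y2 w1 w2 : 'cV[R]_(k + q)),
     enorm (f t y1 w1 - f t y2 w2) <= l * (enorm (y1 - y2) + enorm (w1 - w2))) ->
  (let M := expR (mu * th) in let m := expR (- mu * th) in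
   l * M * th * (1 + M * (1 + l * th) * expR (M * l * th)) < m) ->
  (forall t : R, derivable Q t 1) -> (forall t : R, Q t \in unitmx) ->
  (forall t : R, block_mx (Bp t) 0 0 (Bm t)
     = invmx (Q t) *m A t *m Q t - invmx (Q t) *m (derive1 Q t)) ->
  theta i <= t0 < theta (i + 1) ->
  let rhs := reduced_rhs Bp Bm (g_plus beta Q f) (g_minus beta Q f) in
  exists2 c : R, 0 <= c & forall z1 z2,
    solution theta beta rhs z1 -> solution theta beta rhs z2 ->
    enorm (z1 (theta i) - z2 (theta i)) <= c * enorm (z1 t0 - z2 t0).
Proof.
move=> sw be th0 mu0 Amu l0 fl; set M := expR (mu * th) => /= small.
move=> dQ uQ blk /andP[it0 t0i]; set rhs := reduced_rhs _ _ _ _.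
set tau := theta i in it0 *.
have M1 : 1 <= M by rewrite -expR0 ler_expR mulr_ge0// ltW.
(* Forward Gronwall factor: the retarded argument is frozen at [tau], so the difference grows at
   rate [mu + l] with constant forcing [l * r0], during a time of at most [th]. *)
pose Dd := expR ((mu + l) * th) * (1 + l * th).
have lth : 0 <= l * th by rewrite mulr_ge0// ltW.
have Dd0 : 0 <= Dd by rewrite mulr_ge0 ?expR_ge0 ?addr_ge0.
have Ddle : Dd <= M * (1 + l * th) * expR (M * l * th).
  rewrite /Dd mulrDl expRD -/M mulrAC ler_wpM2l//.
    by rewrite mulr_ge0 ?expR_ge0 ?addr_ge0.
  by rewrite ler_expR -[leLHS]mul1r -mulrA ler_wpM2r.
(* The condition on [l] enters here: [Dd] is at most the product inside its bracket, and its
   right-hand side [m] is at most 1. *)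
have kap : 0 < 1 - M * (l * (Dd + 1) * th).
  have m1 : expR (- mu * th) <= 1.
    by rewrite -expR0 ler_expR mulNr oppr_le0 mulr_ge0// ltW.
  rewrite subr_gt0; apply: lt_le_trans m1; apply: le_lt_trans small.
  have -> : M * (l * (Dd + 1) * th) = l * M * th * (1 + Dd) by ring.
  rewrite ler_wpM2l ?lerD2l// mulr_ge0 ?(ltW th0)// mulr_ge0// expR_ge0//.
set kappa := 1 - _ in kap.
have t0th : t0 - tau <= th by have [_ _ /(_ i)] := sw; rewrite /tau; lra.
exists (opnorm (invmx (Q tau)) * (M / kappa * opnorm (Q t0))).
  by rewrite mulr_ge0// mulr_ge0// divr_ge0 ?expR_ge0// ltW.
move=> z1 z2 [c1 /(_ i)[s1 _]] [c2 /(_ i)[s2 _]].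
pose w s := z1 s - z2 s; pose d s := Q s *m w s.
have cd : continuous d.
  move=> s; apply: continuous_mulmx.
    exact/differentiable_continuous/derivable1_diffP.
  by apply: cvgB; [exact: c1|exact: c2].
have btau s : tau <= s < theta (i + 1) -> beta s = tau by exact: be.
have dd s : tau < s < theta (i + 1) -> exists2 d', is_derive s 1 d d' &
    enorm d' <= mu * enorm (d s) + l * (enorm (d s) + enorm (d tau)).
  move=> sb; have sb' : tau <= s < theta (i + 1) by case/andP: sb => /ltW -> ->.
  have dw := is_deriveB (s1 s sb) (s2 s sb).
  have dQs : is_derive s 1 Q (derive1 Q s) by rewrite derive1E; exact/derivableP.
  pose D := derive1 Q s *m w s
    + Q s *m (rhs s (z1 s) (z1 (beta s)) - rhs s (z2 s) (z2 (beta s))).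
  have dd : is_derive s 1 d D by exact: (is_derive_mulmx _ _ _ _ _ dQs dw).
  pose f1 := f s (Q s *m z1 s) (Q tau *m z1 tau).
  pose f2 := f s (Q s *m z2 s) (Q tau *m z2 tau).
  (* In the original coordinates [d = Q w] the block system becomes [A] again, since the terms with
     the derivative of [Q] cancel. *)
  have DE : D = A s *m d s + (f1 - f2).
    have rhsE z v : rhs s z v = block_mx (Bp s) 0 0 (Bm s) *m z +
        reduced_g beta Q f s z v.
      rewrite /rhs /reduced_rhs /g_plus /g_minus.
      rewrite -[in RHS](vsubmxK z) mul_block_col !mul0mx addr0 add0r.
      by rewrite -[X in _ = _ + X]vsubmxK add_col_mx vsubmxK.
    rewrite /D !rhsE /reduced_g !btau// -/f1 -/f2 blk.
    set Bk := _ - invmx _ *m _.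
    rewrite (_ : _ - _ = Bk *m w s + invmx (Q s) *m (f1 - f2)); last first.
      by rewrite opprD addrACA -!mulmxBr.
    have QBk : Q s *m (Bk *m w s) = A s *m d s - derive1 Q s *m w s.
      have QB : Q s *m Bk = A s *m Q s - derive1 Q s.
        by rewrite /Bk mulmxBr !mulmxA mulmxV// !mul1mx.
      by rewrite mulmxA QB mulmxBl -[A s *m Q s *m _]mulmxA.
    rewrite [Q s *m (_ + _)]mulmxDr [Q s *m (invmx _ *m _)]mulmxA mulmxV// mul1mx.
    rewrite QBk addrA.
    by congr (_ + _); rewrite addrC subrK.
  exists D; first exact: dd.
  rewrite DE (le_trans (enormD _ _))// lerD//; first exact: opnorm_le.
  by have := fl s (Q s *m z1 s) (Q s *m z2 s) (Q tau *m z1 tau) (Q tau *m z2 tau);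
    rewrite -!mulmxBr.
set r0 := enorm (d tau) in dd.
have r00 : 0 <= r0 by exact: enorm_ge0.
have fwd s : tau <= s -> s <= t0 -> enorm (d s) <= Dd * r0.
  move=> ts st; have := gronwall d (mu + l) (l * r0) tau s
    (mulr_ge0 l0 r00) (addr_ge0 mu0 l0) ts cd _.
  rewrite -/r0 => /(_ _)-h.
  have {}h : enorm (d s) <= expR ((mu + l) * (s - tau)) * (r0 + l * r0 * (s - tau)).
    apply: h => x /andP[x1 x2]; have [|d' dx le] := dd x.
      by rewrite x1 (lt_trans x2)// (le_lt_trans st).
    by exists d' => //; lra.
  have sth : s - tau <= th by lra.
  apply: (le_trans h); rewrite /Dd -[leRHS]mulrA ler_pM ?expR_ge0//.
  - apply: addr_ge0 => //; apply: mulr_ge0; first exact: mulr_ge0.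
    by rewrite subr_ge0.
  - by rewrite ler_expR ler_wpM2l// addr_ge0.
  - rewrite mulrDl mul1r lerD2l mulrAC ler_wpM2r// ler_wpM2l//.
(* Backward Gronwall with the forward bound inserted in the forcing. The quantity [r0] occurs on
   both sides and is absorbed because [kappa] is positive. *)
have bwd : r0 <= M * (enorm (d t0) + l * (Dd + 1) * r0 * th).
  have G0 : 0 <= l * (Dd + 1) * r0 by rewrite !mulr_ge0// addr_ge0.
  have h : r0 <= expR (mu * (t0 - tau)) *
      (enorm (d t0) + l * (Dd + 1) * r0 * (t0 - tau)).
    apply: gronwall_bwd => // x /andP[x1 x2]; have [|d' dx le] := dd x.
      by rewrite x1 (lt_trans x2).
    exists d' => //; rewrite (le_trans le)// lerD2l -mulrA ler_wpM2l//.
    by rewrite mulrDl mul1r lerD2r fwd// ltW.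
  apply: (le_trans h); rewrite ler_pM ?expR_ge0//.
  - by rewrite addr_ge0// mulr_ge0// subr_ge0.
  - by rewrite ler_expR ler_wpM2l.
  - by rewrite lerD2l ler_wpM2l.
have r0le : r0 <= M / kappa * enorm (d t0).
  rewrite mulrAC ler_pdivlMr// /kappa; lra.
have wE : w tau = invmx (Q tau) *m d tau by rewrite /d mulmxA mulVmx// mul1mx.
rewrite -/(w tau) -/(w t0) wE (le_trans (opnormP _ _))// -mulrA ler_wpM2l//.
apply: (le_trans r0le); rewrite -[leRHS]mulrA ler_wpM2l//.
  by rewrite divr_ge0 ?expR_ge0// ltW.
exact: opnormP.
Qed.

(** The continuation replaces the local solution, whose values before [beta t0] are arbitrary; both
    agree at [t0] and later. *)
Lemma splus_solution {R : realType} {k q : nat} (theta : int -> R)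
    (beta : R -> R)
    (rhs : R -> 'cV[R]_(k + q) -> 'cV[R]_(k + q) -> 'cV[R]_(k + q))
    (K sigma th eps alpha L : R) (F : R -> 'cV[R]_k -> 'cV[R]_q) :
  splus_function theta beta rhs K sigma th eps alpha L F ->
  forall t0 u0, beta t0 <= t0 -> exists z : R -> 'cV[R]_(k + q),
    [/\ solution theta beta rhs z, z t0 = col_mx u0 (F t0 u0)
      & forall t : R, t0 <= t ->
          enorm (z t) <= (K + eps) * enorm u0 * expR (- alpha * (t - t0))].
Proof.
move=> [_ _ _ h] t0 u0 bt0; have [z [[_ _ z0] [y sy yz] zb]] := h t0 u0.
exists y; split=> // [|t tt0]; first by rewrite yz.
by rewrite yz ?zb// (le_trans bt0).
Qed.

(** On the compact interval [[tau, t0]] continuity bounds [z], and the factor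
    [exp(alpha (t0 - tau))] shifts the origin of the exponential. The constant depends on [z], but
    only its existence is required of a decaying solution. *)
Lemma decay_from_earlier {R : realType} {n} (z : R -> 'cV[R]_n)
    (alpha tau t0 N : R) : 0 < alpha -> tau <= t0 -> continuous z ->
  (forall t, t0 <= t -> enorm (z t) <= N * expR (- alpha * (t - t0))) ->
  exists N' : R, forall t, tau <= t ->
    enorm (z t) <= N' * expR (- alpha * (t - tau)).
Proof.
move=> a0 tt0 cz hN.
have [|c _ hc] := @EVT_max R (fun s => enorm (z s)) tau t0 tt0.
  by apply: continuous_subspaceT => s; apply: continuous_enorm; exact: cz.
have N0 : 0 <= N.
  by have := hN t0 (lexx _); rewrite subrr mulr0 expR0 mulr1; exact: le_trans.
exists ((enorm (z c) + N) * expR (alpha * (t0 - tau))) => t it.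
rewrite -mulrA -expRD.
rewrite (_ : alpha * (t0 - tau) + _ = - alpha * (t - t0)); last by ring.
have [tl|tl] := leP t t0.
  have : enorm (z t) <= enorm (z c) by apply: hc; rewrite in_itv/= it.
  move=> h; apply: (le_trans h); rewrite -[leLHS]mulr1 ler_pM ?lerDl//.
  by rewrite -expR0 ler_expR mulNr -mulrN mulr_ge0 ?(ltW a0)// opprB subr_ge0.
rewrite (le_trans (hN t (ltW tl)))// ler_wpM2r ?expR_ge0//.
by rewrite lerDr.
Qed.

(** The threshold [L0] is chosen before the dimensions, the switching times and the equation, so the
    smallness of [L] depends on [K], [sigma], [th], [eps] and [alpha] only. The dimension is written
    [k + q] with [k] the rank of [P]. *)
Theorem theorem2p7 (R : realType) (K sigma th eps alpha : R)
    (hK : 0 < K) (hsigma : 0 < sigma) (hth : 0 < th) (heps : 0 < eps)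
    (halpha : 0 < alpha < sigma) :
  exists2 L0 : R, 0 < L0 &
  forall (k q : nat) (theta : int -> R) (beta : R -> R)
    (A : R -> 'M[R]_(k + q))
    (f : R -> 'cV[R]_(k + q) -> 'cV[R]_(k + q) -> 'cV[R]_(k + q))
    (mu l : R) (X : R -> 'M[R]_(k + q)) (P : 'M[R]_(k + q))
    (Q : R -> 'M[R]_(k + q)) (Bp : R -> 'M[R]_k) (Bm : R -> 'M[R]_q)
    (U : R -> R -> 'M[R]_k) (V : R -> R -> 'M[R]_q) (L : R)
    (F : R -> 'cV[R]_k -> 'cV[R]_q),
  switching_times th theta ->
  is_beta theta beta ->
  continuous A ->
  has_ubound (range (fun t : R => opnorm (A t))) ->
  mu = sup (range (fun t : R => opnorm (A t))) ->
  (forall y w : 'cV[R]_(k + q), continuous (fun t : R => f t y w)) ->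
  (forall t : R, f t 0 0 = 0) ->
  0 <= l ->
  (forall (t : R) (y1 y2 w1 w2 : 'cV[R]_(k + q)),
     enorm (f t y1 w1 - f t y2 w2) <= l * (enorm (y1 - y2) + enorm (w1 - w2))) ->
  exp_dichotomy A X P K sigma ->
  \rank P = k ->
  (let M := expR (mu * th) in let m := expR (- mu * th) in
   l * M * th * (1 + M * (1 + l * th) * expR (M * l * th)) < m) ->
  unif_cont_diff f ->
  lyapunov_matrix Q ->
  (forall t : R, block_mx (Bp t) 0 0 (Bm t)
     = invmx (Q t) *m A t *m Q t - invmx (Q t) *m (derive1 Q t)) ->
  transition_matrix Bp U ->
  transition_matrix Bm V ->
  (forall t s : R, s <= t -> opnorm (U t s) <= K * expR (- sigma * (t - s))) ->
  (forall t s : R, t <= s -> opnorm (V t s) <= K * expR (- sigma * (s - t))) ->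
  0 <= L ->
  (forall (t : R) (z1 z2 w1 w2 : 'cV[R]_(k + q)),
     enorm (g_plus beta Q f t z1 w1 - g_plus beta Q f t z2 w2)
     + enorm (g_minus beta Q f t z1 w1 - g_minus beta Q f t z2 w2)
       <= L * (enorm (z1 - z2) + enorm (w1 - w2))) ->
  L < L0 ->
  splus_function theta beta
    (reduced_rhs Bp Bm (g_plus beta Q f) (g_minus beta Q f))
    K sigma th eps alpha L F ->
  forall t : R, cont_diff (F t).
Proof.
have [a0 a_s] := andP halpha.
pose D := K * ((sigma - alpha)^-1 + (sigma + alpha)^-1).
have D0 : 0 < D.
  by rewrite mulr_gt0// addr_gt0// invr_gt0; lra.
have e0 : 0 < 1 + expR (alpha * th) by rewrite addr_gt0// expR_gt0.
(* The largest threshold for which [L < L0] yields the contraction condition [LD] by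
   rearrangement. *)
exists (2 * ((1 + expR (alpha * th)) * D))^-1.
  by rewrite invr_gt0 mulr_gt0// mulr_gt0.
move=> k q theta beta A f mu l X P Q Bp Bm U V L F sw be _ Aub muE _ _ l0 fl.
move=> _ _ small fC1 [dQ _ uQ [bQ bQ' bQi]] blk tU tV UK VK L0 gL LL0 SF t.
have Amu s : opnorm (A s) <= mu.
  by rewrite muE; apply: sup_ubound => //; exists s.
have mu0 : 0 <= mu by exact: le_trans (Amu 0).
have LD : L * (1 + expR (alpha * th)) * D <= 2^-1.
  have ED : 0 < (1 + expR (alpha * th)) * D by rewrite mulr_gt0.
  by move: LL0; rewrite invfM ltr_pdivlMr// mulrA => /ltW.
have [C [C0 BpC BmC]] := generator_bounded A Q Bp Bm
  (ex_intro _ mu Amu) bQ bQ' bQi blk.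
have [gx [gw gd]] := reduced_g_strict beta Q f fC1 bQ bQi.
have UK' r s x : s <= r -> enorm (U r s *m x) <= K * expR (- sigma * (r - s)) * enorm x.
  by move=> sr; apply: opnorm_le; exact: UK.
have VK' r s x : r <= s -> enorm (V r s *m x) <= K * expR (- sigma * (s - r)) * enorm x.
  by move=> rs; apply: opnorm_le; exact: VK.
have [i it] := switching_floor _ _ sw t; have [it1 it2] := andP it.
set rhs := reduced_rhs _ _ _ _ in SF.
have bt : beta t <= t by rewrite (be i t it).
have btau : beta (theta i) <= theta i.
  by rewrite (be i (theta i))// lexx; have [/(_ i)] := sw.
(* [zf a] starts on the graph of [F] at the switching time [theta i], whereas [y u] below starts on
   it at time [t]. *)
have [zf hzf] := choice (fun a => splus_solution _ _ _ _ _ _ _ _ _ _ SF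
  (theta i) a btau).
have [y hy] := choice (fun u => splus_solution _ _ _ _ _ _ _ _ _ _ SF t u bt).
pose dec (z : R -> 'cV[R]_(k + q)) := exists N : R, forall s, theta i <= s ->
  enorm (z s) <= N * expR (- alpha * (s - theta i)).
have hz a : [/\ solution theta beta rhs (zf a), usubmx (zf a (theta i)) = a
    & dec (zf a)].
  have [sz za zd] := hzf a; split=> //; first by rewrite za col_mxKu.
  by eexists; exact: zd.
have dy u : dec (y u).
  have [[cy _] _ yd] := hy u.
  exact: decay_from_earlier a0 it1 cy yd.
pose al u := usubmx (y u (theta i)).
(* Both solutions decay and have the same first block at [theta i], so they coincide from there
   on. *)
have yz u s : theta i <= s -> y u s = zf (al u) s.
  move=> is'; apply/eqP; rewrite -subr_eq0; apply/eqP/enorm_le0.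
  have [sy _ _] := hy u; have [sz zu dz] := hz (al u).
  have := solution_diff th theta beta Bp Bm U V C K sigma alpha L
    (reduced_g beta Q f) sw be C0 BpC BmC tU tV hK halpha UK' VK' L0 LD gL i
    _ _ sy sz (dy u) dz s is'.
  by rewrite zu subrr enorm0 mulr0 mul0r.
have [c c0 hc] := backward_lipschitz th theta beta A Q f Bp Bm mu l i t sw be
  hth mu0 Amu l0 fl small dQ uQ blk it.
have [_ _ FL _] := SF.
set Lip := 2 * K ^+ 2 * L * _ / _ in FL.
have Lip0 : 0 <= Lip.
  rewrite /Lip divr_ge0//; last by lra.
  by rewrite mulr_ge0 ?addr_ge0 ?expR_ge0// mulr_ge0// mulr_ge0// sqr_ge0.
apply: strict_cont_diff.
(* [c] bounds the backward passage from [t] to [theta i], and [1 + Lip] is a Lipschitz constant of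
   [u |-> (u, F t u)]. *)
apply: (graph_strict (fun a => zf a t) al (F t) (c * (1 + Lip))).
- exact: (family_strict th theta beta Bp Bm U V C K sigma alpha L
    (reduced_g beta Q f) gx gw sw be C0 BpC BmC tU tV hK halpha UK' VK' L0 LD gL
    gd i zf hz t it1).
- by move=> u; rewrite -yz//; have [_ ->] := hy u.
- by rewrite mulr_ge0// addr_ge0.
- move=> u1 u2; have [s1 y1 _] := hy u1; have [s2 y2 _] := hy u2.
  rewrite /al -linearB; apply: (le_trans (enorm_usub _)).
  apply: (le_trans (hc _ _ s1 s2)); rewrite -mulrA ler_wpM2l//.
  rewrite y1 y2 opp_col_mx add_col_mx (le_trans (enorm_le_split _))//.
  by rewrite col_mxKu col_mxKd mulrDl mul1r lerD2l FL.
Qed.
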